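(* Let $d \in \mathbb{N}$, $\alpha > -1$, $n \in \mathbb{N}_0$ and $p_n \in \mathcal{V}^{\alpha,1}_n$. Then, for all $q\in \mathrm{C}^2(\overline{B^d})$, $$B^{\alpha,1}(p_n,q) := \sum_{k=1}^d B^\alpha(\partial_k p_n, \partial_k q) = \langle \nabla\nabla p_n, \nabla\nabla q \rangle_{\alpha+1} + \sum_{1 \leq i < j \leq d} \langle D_{i,j} \nabla p_n, D_{i,j} \nabla q \rangle_\alpha = \lambda^{(\alpha,1)}_n \, \langle p_n, q \rangle_{\alpha,1},$$ where $\lambda^{(\alpha,1)}_n = 0$ if $n \leq 1$ and $\lambda^{(\alpha,1)}_n=(n-1)(n-1+d+2\alpha)$ if $n\geq 2$.
   Context: $\mathbb{N}$ is the set of positive integers and $\mathbb{N}_0=\mathbb{N}\cup\{0\}$. $B^d$ is the open unit ball of $\mathbb{R}^d$ and functions are complex-valued. For $\alpha>-1$, $\langle u,v\rangle_\alpha=\int_{B^d}u\,\overline{v}\,(1-\lVert x\rVert^2)^\alpha\,dx$, also used for vector- and tensor-valued functions (summing over components). $\Pi^d_n$ is the space of $d$-variate polynomials of total degree at most $n$, with $\Pi^d_n=\{0\}$ for $n<0$. Let $\langle u,v\rangle_{\alpha,1}=\langle\nabla u,\nabla v\rangle_\alpha+c_\alpha^{-1}\langle u,1\rangle_\alpha\overline{\langle v,1\rangle_\alpha}$ with $c_\alpha=\langle1,1\rangle_\alpha$, and $\mathcal{V}^{\alpha,1}_n=\{p\in\Pi^d_n: \langle p,q\rangle_{\alpha,1}=0\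 \forall q\in\Pi^d_{n-1}\}$. $D_{i,j}=x_i\partial_j-x_j\partial_i$, applied entrywise to vector-valued functions. $B^\alpha(p,q)=\langle\nabla p,\nabla q\rangle_{\alpha+1}+\sum_{1\le i<j\le d}\langle D_{i,j}p,D_{i,j}q\rangle_\alpha$. $\nabla\nabla$ denotes the Hessian (twofold gradient). $\mathrm{C}^2(\overline{B^d})$ is the space of functions on $B^d$ whose partial derivatives up to order 2 extend continuously to $\overline{B^d}$. *)

(* Defs.v *)
From HB Require Import structures.
From mathcomp Require Import all_boot all_order all_algebra.
From mathcomp Require Import complex.
From mathcomp Require Import -(notations) mpoly.
From mathcomp Require Import all_classical all_reals all_analysis.

Set Implicit Arguments.
Unset Strict Implicit.
Unset Printing Implicit Defensive.

Import Order.TTheory GRing.Theory Num.Theory.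
Import numFieldNormedType.Exports.

Local Open Scope classical_set_scope.
Local Open Scope ring_scope.
Local Open Scope complex_scope.

(* Lebesgue measure on R^d.  The library has the product sigma-algebra on
   tuples but only binary product measures, so the d-fold product is built by
   recursion, transported along R * R^n -> R^(n+1). *)
Section lebesgue_cons.
Local Open Scope ereal_scope.
Context {R : realType} (n : nat).
Local Notation mR := (measurableTypeR R).

Definition cons_pair (xt : mR * n.-tuple mR) : n.+1.-tuple mR :=
  [tuple of xt.1 :: xt.2].

Lemma measurable_cons_pair : measurable_fun [set: mR * n.-tuple mR] cons_pair.
Proof. exact: measurable_cons. Qed.

Definition uncons_pair (t : n.+1.-tuple mR) : mR * n.-tuple mR :=
  (thead t, [tuple of behead t]).

Lemma measurable_uncons_pair :
  measurable_fun [set: n.+1.-tuple mR] uncons_pair.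
Proof.
by apply: measurable_fun_pair; [exact: measurable_tnth|exact: measurable_behead].
Qed.

Lemma cons_pairK : cancel cons_pair uncons_pair.
Proof.
move=> [x t]; congr pair.
exact/val_inj.
Qed.

Variable m : {sigma_finite_measure set (n.-tuple mR) -> \bar R}.

Definition lebesgue_cons : set (n.+1.-tuple mR) -> \bar R :=
  pushforward (lebesgue_measure \x m) cons_pair.

Let lebesgue_cons0 : lebesgue_cons set0 = 0.
Proof. by rewrite /lebesgue_cons /pushforward preimage_set0 measure0. Qed.

Let lebesgue_cons_ge0 A : 0 <= lebesgue_cons A.
Proof. exact: (measure_ge0 (lebesgue_measure \x m)). Qed.

Let lebesgue_cons_sigma_additive : semi_sigma_additive lebesgue_cons.
Proof.
move=> F mF tF mUF; rewrite /lebesgue_cons /pushforward preimage_bigcup.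
have mp A : measurable A -> measurable (cons_pair @^-1` A).
  by move=> mA; rewrite -[X in measurable X]setTI; exact: measurable_cons_pair.
apply: (@measure_semi_sigma_additive _ _ _ (lebesgue_measure \x m)).
- by move=> k; apply: mp; exact: mF.
- apply/trivIsetP => /= i j _ _ ij; rewrite -preimage_setI.
  by move/trivIsetP : tF => /(_ _ _ _ _ ij) ->//; rewrite preimage_set0.
- by rewrite -preimage_bigcup; exact: mp.
Qed.

HB.instance Definition _ := isMeasure.Build _ _ _ lebesgue_cons
  lebesgue_cons0 lebesgue_cons_ge0 lebesgue_cons_sigma_additive.

Let lebesgue_cons_sigma_finite : sigma_finite setT lebesgue_cons.
Proof.
have /sigma_finiteP[F [TF ndF Foo]] := sigma_finiteT (@lebesgue_measure R).
have /sigma_finiteP[G [TG ndG Goo]] := sigma_finiteT m.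
exists (fun k => uncons_pair @^-1` (F k `*` G k)).
  rewrite -preimage_bigcup (_ : \bigcup_k _ = setT) ?preimage_setT//.
  rewrite -setXTT TF TG; apply/seteqP; split=> [[x y]|[x y]] /=.
    by move=> [k _ []/= ? ?]; split; exists k.
  move=> [/= [i _ Fix] [j _ Gjy]]; exists (maxn i j) => //; split.
    by move: x Fix; exact/subsetPset/ndF/leq_maxl.
  by move: y Gjy; exact/subsetPset/ndG/leq_maxr.
move=> k; have [mF Fk] := Foo k; have [mG Gk] := Goo k; split.
  rewrite -[X in measurable X]setTI; apply: measurable_uncons_pair => //.
  exact: measurableX.
rewrite /lebesgue_cons /pushforward -comp_preimage.
rewrite (_ : _ \o _ = id) ?preimage_id; last exact/funext/cons_pairK.
by rewrite product_measure1E// lte_mul_pinfty// ge0_fin_numE.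
Qed.

HB.instance Definition _ := Measure_isSigmaFinite.Build _ _ _ lebesgue_cons
  lebesgue_cons_sigma_finite.

End lebesgue_cons.

Fixpoint lebesgue_tuple {R : realType} (d : nat) :
    {sigma_finite_measure set (d.-tuple (measurableTypeR R)) -> \bar R} :=
  if d is n.+1 then lebesgue_cons (lebesgue_tuple n) else \d_([tuple]).

Lemma lebesgue_tuple_box {R : realType} (d : nat) (A : 'I_d -> set R) :
  (forall i, measurable (A i : set (measurableTypeR R))) ->
  (lebesgue_tuple d [set t | forall i, A i (tnth t i)] =
   \prod_(i < d) lebesgue_measure (A i))%E.
Proof.
elim: d A => [|n IHn] A mA.
  rewrite big_ord0 /= diracE mem_set// => -[]//.
rewrite big_ord_recl -IHn//= /lebesgue_cons /pushforward.
rewrite -product_measure1E//.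
  congr ((_ \x _)%E _); apply/seteqP; split => [[x t]/= H|[x t]/= [H0 H] i].
    split=> [|i]; first by have := H ord0; rewrite tnth0.
    by have := H (lift ord0 i); rewrite tnthS.
  case: (unliftP ord0 i) => [j|] ->; first by rewrite tnthS.
  by rewrite tnth0.
rewrite (_ : [set t | _] = \bigcap_(i in [set: 'I_n])
    ((@tnth n (measurableTypeR R))^~ i @^-1` A (lift ord0 i))).
  apply: fin_bigcap_measurable => // i _.
  by rewrite -[X in measurable X]setTI; exact: measurable_tnth.
by apply/seteqP; split => t /= H i; [move=> _; exact: H|exact: H].
Qed.

Section forms.
Context {R : realType} {d : nat}.
Local Notation Rd := 'rV[R]_d.
Local Notation Re := (@complex.Re R).
Local Notation Im := (@complex.Im R).
Implicit Types (u v p q : Rd -> R[i]) (x : Rd) (alpha : R).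

Definition row_of_tuple (t : d.-tuple (measurableTypeR R)) : Rd :=
  \row_i tnth t i.

Definition Cintegral (A : set Rd) u : R[i] :=
  (\int[lebesgue_tuple d]_(t in row_of_tuple @^-1` A)
     Re (u (row_of_tuple t))) +i*
  (\int[lebesgue_tuple d]_(t in row_of_tuple @^-1` A)
     Im (u (row_of_tuple t))).

(* The library norm on row vectors is the sup norm. *)
Definition enorm x : R := Num.sqrt (\sum_(i < d) x 0 i ^+ 2).

Definition unit_ball : set Rd := [set x | enorm x < 1].

Definition pderivable (k : 'I_d) u x : Prop :=
  derivable (Re \o u) x (delta_mx 0 k) /\
  derivable (Im \o u) x (delta_mx 0 k).

Definition partial (k : 'I_d) u : Rd -> R[i] := fun x =>
  ('D_(delta_mx 0 k) (Re \o u) x) +i*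
  ('D_(delta_mx 0 k) (Im \o u) x).

Definition grad u : 'I_d -> Rd -> R[i] := fun k => partial k u.

Definition hessian u : 'I_d * 'I_d -> Rd -> R[i] :=
  fun kl => grad (grad u kl.1) kl.2.

Definition angular (i j : 'I_d) u : Rd -> R[i] := fun x =>
  (x 0 i)%:C * partial j u x - (x 0 j)%:C * partial i u x.

Definition angular_vec (I : Type) (i j : 'I_d) (U : I -> Rd -> R[i]) :
  I -> Rd -> R[i] := fun k => angular i j (U k).

(* Functions on the ball are total functions on R^d of which only the values on
   the ball matter. *)
Definition extends_continuously u : Prop :=
  exists v : Rd -> R[i],
    [/\ {within closure unit_ball, continuous (Re \o v)},
        {within closure unit_ball, continuous (Im \o v)} &
        forall x, unit_ball x -> v x = u x].

Fixpoint Cbar (m : nat) u : Prop :=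
  extends_continuously u /\
  if m is m'.+1 then
    forall k : 'I_d,
      (forall x, unit_ball x -> pderivable k u x) /\ Cbar m' (partial k u)
  else True.

Definition ip alpha u v : R[i] :=
  Cintegral unit_ball
    (fun x => u x * conjc (v x) * ((1 - enorm x ^+ 2) `^ alpha)%:C).

Definition ipv (I : finType) alpha (U V : I -> Rd -> R[i]) : R[i] :=
  \sum_(i : I) ip alpha (U i) (V i).

Definition one_fun : Rd -> R[i] := fun=> 1.

Definition ip1 alpha u v : R[i] :=
  ipv alpha (grad u) (grad v) +
  (ip alpha one_fun one_fun)^-1 * ip alpha u one_fun *
    conjc (ip alpha v one_fun).

Definition Bform alpha p q : R[i] :=
  ipv (alpha + 1) (grad p) (grad q) +
  \sum_(i < d) \sum_(j < d | (i < j)%N)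
    ip alpha (angular i j p) (angular i j q).

Definition Bform1 alpha p q : R[i] :=
  \sum_(k < d) Bform alpha (partial k p) (partial k q).

Definition poly_fun (p : mpoly d R[i]) : Rd -> R[i] :=
  fun x => meval (fun i => (x 0 i)%:C) p.

(* msize is the total degree plus one, and 0 for the zero polynomial. *)
Definition poly_space (m : int) (p : mpoly d R[i]) : Prop :=
  if m is Posz n then (msize p <= n.+1)%N else p = 0.

Definition orth_space alpha (n : nat) (p : mpoly d R[i]) : Prop :=
  poly_space n p /\
  forall q : mpoly d R[i], poly_space (n%:Z - 1) q ->
    ip1 alpha (poly_fun p) (poly_fun q) = 0.

End forms.

Definition lambda1 {R : realType} (d : nat) (alpha : R) (n : nat) : R :=
  if (n <= 1)%N then 0 else (n%:R - 1) * (n%:R - 1 + d%:R + 2 * alpha).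

(* Main.v *)
(* Write [a] for alpha, [E = x . grad], [L = E (E + d + 2a) - Laplacian] and
   [M = (E - 1) (E - 1 + d + 2a) - Laplacian].  Integration by parts gives
   [B^a(u, v) = <L u, v>_a] for polynomials [u] and [v] in [C^1], and
   [d_k M = L d_k], hence [B^{a,1}(p, q) = <grad (M p), grad q>_a].  Thus [M] is
   symmetric for [<grad ., grad .>_a] on polynomials.  It preserves the degree and
   multiplies the leading part of [p_n] by [lambda_n], so that
   [r = M p_n - lambda_n p_n] has degree less than [n]; by symmetry [grad r] is
   orthogonal to [grad Pi_{n-1}], hence to itself, and it vanishes in [L^2].

   The integrations by parts are first carried out against a cutoff
   [phi_e(s) = max(s - e, 0)^2 s^(b-2)] of [s^b], with [s = 1 - |x|^2]: the
   integrand is then the derivative of a [C^1] function on [R^d] with compact support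
   in the ball, and its integral vanishes by Fubini and the fundamental theorem of
   calculus.  Then [e] tends to [0]. *)

Require Import Defs.
From HB Require Import structures.
From mathcomp Require Import all_boot all_order all_algebra.
From mathcomp Require Import complex.
From mathcomp Require Import -(notations) mpoly.
From mathcomp Require Import all_classical all_reals all_analysis.
From mathcomp Require Import measurable_realfun.
From mathcomp Require Import ring lra.

Set Implicit Arguments.
Unset Strict Implicit.
Unset Printing Implicit Defensive.

Import Order.TTheory GRing.Theory Num.Theory.
Import numFieldNormedType.Exports.

Local Open Scope classical_set_scope.
Local Open Scope ring_scope.

(** * Borel measurability on row vectors *)

Section row_measurability.
Context {R : realType} {d : nat}.
Implicit Types (U : set 'rV[R]_d) (f : 'rV[R]_d -> R).

(** The obstacle is the boundary of the ball: for [alpha] in (-1, 0) the weight blows up there, and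
    [s^(alpha+1)] tends to 0 without being differentiable up to it. Integrands supported inside the
    ball reduce every integration by parts to one-dimensional slices, and even the integrability of
    the weight is extracted from such an identity. Since [q] is only C^2, derivatives always move
    from the second argument onto the polynomial: each [d_k q] is differentiated once more, and all
    higher orders fall on [p_n]. The angular terms carry the more singular weight [s^alpha] and
    still leave no boundary term, because [D_{i,j}] annihilates [|x|^2], hence every function of
    [s]. The index 0 stands apart: the eigenvalue formula would give [1 - d - 2a] there instead of
    0, and the rank-one term of the Sobolev product disappears only once the constants lie in
    [Pi_{n-1}]. *)

Lemma measurable_open_rV U :
  open U -> measurable (row_of_tuple @^-1` U : set (d.-tuple (measurableTypeR R))).
Proof.
move=> oU.
(* The topology lives on row vectors and the sigma-algebra on tuples. Open boxes with rational
   corners link them: those inside [U] cover it and are countably many. In [F], a code whose box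
   leaves [U] contributes the empty set. *)
pose box (a : {ffun 'I_d -> rat * rat}) : set 'rV[R]_d :=
  [set x | forall i, x 0 i \in `]ratr (a i).1, ratr (a i).2[].
pose F (k : nat) : set 'rV[R]_d :=
  if unpickle k is Some a then
    if pselect (box a `<=` U) then box a else set0 else set0.
have -> : U = \bigcup_k F k.
  apply/seteqP; split=> [x Ux|x [k _]]; last first.
    rewrite /F; case: (unpickle k) => // a; case: pselect => // aU.
    exact: aU.
  have /nbhs_ballP[e /= e0 xeU] : nbhs x U by apply: open_nbhs_nbhs.
  have xlt i : x 0 i - e < x 0 i by rewrite ltrBlDr ltrDl.
  have ltx i : x 0 i < x 0 i + e by rewrite ltrDl.
  pose a := [ffun i : (ordinal d) => (sval (cid (rat_in_itvoo (xlt i))),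
                        sval (cid (rat_in_itvoo (ltx i))))].
  have xa : box a x.
    move=> i; rewrite !ffunE/= in_itv/=.
    case: cid => p /=; case: cid => q /=; rewrite !in_itv/=.
    by move=> /andP[-> _] /andP[_ ->].
  have aU : box a `<=` U.
    move=> y ya; apply: xeU; split => // i j; rewrite ord1.
    move: (ya j); rewrite !ffunE/= in_itv/=.
    case: cid => p /=; case: cid => q /=; rewrite !in_itv/=.
    move=> /andP[? ?] /andP[? ?] /andP[? ?].
    rewrite /ball/= ltr_norml; lra.
  by exists (pickle a) => //; rewrite /F pickleK; case: pselect.
rewrite preimage_bigcup; apply: bigcupT_measurable => k; rewrite /F.
case: (unpickle k) => [a|]; last by rewrite preimage_set0.
case: pselect => [? |?] /=; last by rewrite preimage_set0.
rewrite (_ : _ @^-1` _ = \bigcap_(i in [set: 'I_d])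
    ((@tnth d (measurableTypeR R))^~ i @^-1` `]ratr (a i).1, ratr (a i).2[)).
  apply: fin_bigcap_measurable => // i _.
  by rewrite -[X in measurable X]setTI; exact: measurable_tnth.
apply/seteqP; split => t /= H i.
  by move=> _; have := H i; rewrite mxE.
by rewrite mxE; exact: H.
Qed.

Lemma measurable_fun_rV U f : open U -> {in U, continuous f} ->
  measurable_fun (row_of_tuple @^-1` U : set (d.-tuple (measurableTypeR R)))
    (f \o row_of_tuple).
Proof.
move=> oU cf; apply: (measurability _ (RGenOpens.measurableE R)).
move=> _ [_ [a [b ->] <-]].
change (measurable (row_of_tuple @^-1` (U `&` f @^-1` `]a, b[)
  : set (d.-tuple (measurableTypeR R)))).
apply: measurable_open_rV.
rewrite openE => x [Ux fx]; apply: filterI; first exact: open_nbhs_nbhs.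
apply: cf; first by rewrite inE.
by apply: open_nbhs_nbhs; split => //; exact: interval_open.
Qed.

End row_measurability.

(** * Fubini along one coordinate *)

Section coordinate_slices.
Context {R : realType}.
Local Notation mR := (measurableTypeR R).
Local Notation mu := (@lebesgue_measure R).

Definition set_coord d (k : 'I_d) (t : d.-tuple mR) (s : R) : d.-tuple mR :=
  [tuple (if i == k then s else tnth t i) | i < d].

Definition cube d : set (d.-tuple mR) :=
  [set t | forall i, `[-1, 1]%classic (tnth t i)].

Lemma measurable_cube d : measurable (@cube d).
Proof.
rewrite (_ : @cube d = \bigcap_(i in [set: 'I_d])
  ((@tnth d (measurableTypeR R))^~ i @^-1` `[-1, 1])).
  apply: fin_bigcap_measurable => // i _.
  by rewrite -[X in measurable X]setTI; exact: measurable_tnth.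
by apply/seteqP; split => t /= h i; [move=> _|]; exact: h.
Qed.

Lemma lebesgue_cube_lty d : (lebesgue_tuple d (@cube d) < +oo)%E.
Proof.
rewrite (lebesgue_tuple_box (A := fun=> `[-1, 1]%classic)) => [|i]; last first.
  exact: measurable_itv.
rewrite ltey_eq prode_fin_num// => i _.
by rewrite lebesgue_measure_itv/= lte_fin; case: ifP.
Qed.

(** Boundedness and support in a cube of finite measure make [H] integrable, so Fubini may choose
    the order of integration: if [k] is the head coordinate it is integrated innermost, otherwise
    the tail is, where induction applies. *)
Lemma integral0_slices d (k : 'I_d) (H : d.-tuple mR -> R) (C : R) :
  measurable_fun setT H -> (forall t, `|H t| <= C) ->
  (forall t i, 1 < `|tnth t i| -> H t = 0) ->
  (forall t, \int[mu]_s (H (set_coord k t s))%:E = 0)%E ->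
  (\int[lebesgue_tuple d]_t (H t)%:E = 0)%E.
Proof.
elim: d k H => [[]//|d IHd] k H mH HC H1 Hk.
have Hcube t : ~ cube t -> H t = 0.
  move=> tcube.
  have /existsNP[i /negP] : ~ (forall i, tnth t i \in `[-1, 1]) by exact: tcube.
  rewrite in_itv/= -ler_norml -ltNge.
  exact: H1.
have iH : (lebesgue_tuple d.+1).-integrable setT (EFin \o H).
  rewrite (_ : EFin \o H = (EFin \o H) \_ (@cube d.+1)); last first.
    apply/funext => t; rewrite patchE; case: ifPn => // /negP tcube.
    by rewrite /= Hcube// => /mem_set.
  apply: (iffLR (integrable_mkcond _ (@measurable_cube _))).
  apply: measurable_bounded_integrable.
  + exact: measurable_cube.
  + exact: lebesgue_cube_lty.
  + exact: measurable_funTS.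
  + by exists C; split; [exact: num_real|move=> M CM t _; exact: le_trans (ltW CM)].
have mHc : measurable_fun setT (H \o @cons_pair R d).
  by apply: measurableT_comp => //; exact: measurable_cons_pair.
have iHc : (mu \x lebesgue_tuple d)%E.-integrable setT
    ((EFin \o H) \o @cons_pair R d).
  apply/integrableP; split; first exact/measurable_EFinP.
  move/integrableP : iH => [_].
  rewrite ge0_integral_pushforward//; first exact: measurable_cons_pair.
  by do 2 apply: measurableT_comp => //.
rewrite integral_pushforward//; last 2 first.
- exact: measurable_cons_pair.
- exact/measurable_EFinP.
rewrite preimage_setT; case: (unliftP ord0 k) Hk => [j ->|->] Hk.
- rewrite -integral12_prod_meas1//; apply: integral0_eq => x _.
  apply: (IHd j (fun t => H (cons_pair (x, t)))) => [|t|t i ti|t].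
  + exact: (measurableT_comp mHc (measurable_pair1 x)).
  + exact: HC.
  + by apply: (H1 _ (lift ord0 i)); rewrite tnthS.
  + rewrite -[RHS](Hk (cons_pair (x, t))); apply: eq_integral => s _.
    congr (H _)%:E; apply: eq_from_tnth => i; rewrite tnth_mktuple.
    case: (unliftP ord0 i) => [i' ->|->]; last by rewrite tnth0.
    by rewrite !tnthS tnth_mktuple (inj_eq lift_inj).
- rewrite -integral21_prod_meas1//; apply: integral0_eq => t _.
  (* The head 0 is a dummy value, overwritten by [set_coord]. *)
  rewrite -[RHS](Hk (cons_pair (0, t))); apply: eq_integral => s _.
  congr (H _)%:E; apply: eq_from_tnth => i; rewrite tnth_mktuple.
  case: (unliftP ord0 i) => [i' ->|->]; last by rewrite tnth0 eqxx.
  by rewrite !tnthS.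
Qed.
End coordinate_slices.

(** * Derivatives of compactly supported functions have integral zero *)

Section compactly_supported_derivative.
Context {R : realType}.
Local Notation mu := (@lebesgue_measure R).

Lemma integral0_derive1 (g h : R -> R) : continuous h ->
  (forall s, is_derive (s : R) (1 : R) g (h s)) ->
  (forall s, 1 <= `|s| -> g s = 0 /\ h s = 0) ->
  (\int[mu]_s (h s)%:E = 0)%E.
Proof.
move=> ch dg gh0.
have cg : continuous g.
  by move=> s; apply: differentiable_continuous; apply/derivable1_diffP.
transitivity (\int[mu]_(s in `[(-1)%R, 1%R]) (h s)%:E)%E.
  rewrite [RHS]integral_mkcond; apply: eq_integral => s _; rewrite patchE.
  case: ifPn => //; rewrite notin_setE /= in_itv/= => /negP.
  by rewrite -ler_norml -ltNge => /ltW/gh0[_ ->].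
rewrite (@continuous_FTC2 _ h g).
- by rewrite (gh0 1 _).1 ?(gh0 (-1) _).1 ?normrN1 ?normr1// subee.
- lra.
- exact: continuous_subspaceT.
- split; first by move=> s _.
  + by apply: cvg_at_right_filter; exact: cg.
  + by apply: cvg_at_left_filter; exact: cg.
- by move=> s _; rewrite derive1E derive_val.
Qed.

(** Both sides have literally the same difference quotient. This gives directional derivatives
    access to the one-variable chain rule and fundamental theorem. *)
Lemma is_derive_lineP d (g : 'rV[R]_d -> R) (x v : 'rV[R]_d) (s l : R) :
  is_derive (x + s *: v) v g l <->
  is_derive s (1 : R) (fun r => g (x + r *: v)) l.
Proof.
have E : (fun r => g (x + r *: v)) \o shift s =
         (fun r => (g \o shift (x + s *: v)) (r *: v)).
  apply/funext => r /=; congr g.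
  by rewrite scalerDl addrCA.
have E' : (fun r : R => r^-1 *: (((fun r => g (x + r *: v)) \o shift s) (r *: 1)
             - g (x + s *: v)))
    = (fun r : R => r^-1 *: ((g \o shift (x + s *: v)) (r *: v)
             - g (x + s *: v))).
  by apply/funext => r; rewrite E /= /GRing.scale/= mulr1.
by split=> h; have [dg gl] := h; apply: DeriveDef; move: dg gl;
  rewrite /derivable /derive E'.
Qed.

Lemma continuous_compact_support_bounded d (h : 'rV[R]_d -> R) :
  continuous h -> (forall (x : 'rV[R]_d) i, 1 <= `|x 0 i| -> h x = 0) ->
  exists C, forall x, `|h x| <= C.
Proof.
move=> ch h0.
have cbox : compact [set x : 'rV[R]_d | forall i, `[-1, 1]%classic (x 0 i)].
  by apply: (@rV_compact R d (fun=> `[-1, 1]%classic)) => _; exact: segment_compact.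
have /compact_bounded[M [_ hM]] :=
  continuous_compact (continuous_subspaceT ch) cbox.
exists (`|M| + 1) => x.
have [xbox|] := pselect (forall i, `[-1, 1]%classic (x 0 i)).
  by apply: (hM (`|M| + 1)); [rewrite ltr_pwDr// ler_norm|exists x].
move=> /existsNP[i /negP]; rewrite in_itv/= -ler_norml -ltNge => /ltW /h0 ->.
by rewrite normr0 addr_ge0.
Qed.

Lemma integral0_partial d (k : 'I_d) (g h : 'rV[R]_d -> R) : continuous h ->
  (forall x, is_derive x (delta_mx 0 k) g (h x)) ->
  (forall (x : 'rV[R]_d) i, 1 <= `|x 0 i| -> g x = 0 /\ h x = 0) ->
  (\int[lebesgue_tuple d]_t (h (row_of_tuple t))%:E = 0)%E.
Proof.
move=> ch dg gh0.
have [C hC] : exists C, forall x, `|h x| <= C.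
  by apply: continuous_compact_support_bounded => // x i /gh0[].
apply: (integral0_slices (k := k) (H := h \o row_of_tuple) (C := C)).
- rewrite -[setT](preimage_setT (@row_of_tuple R d)).
  by apply: measurable_fun_rV; [exact: openT|move=> x _; exact: ch].
- by move=> t; exact: hC.
- by move=> t i ti; apply: (gh0 _ i _).2; rewrite mxE ltW.
- move=> t.
  (* Base point of the slice, normalised so that the line parameter is the [k]-th coordinate
     itself. *)
  pose x0 := row_of_tuple (set_coord k t 0).
  have xE s : row_of_tuple (set_coord k t s) = x0 + s *: delta_mx 0 k.
    apply/rowP => i; rewrite !mxE !tnth_mktuple eqxx/=.
    by case: (i == k); rewrite ?(mulr1, add0r, mulr0, addr0).
  have xkE s : (x0 + s *: delta_mx 0 k) 0 k = s.
    by rewrite !mxE tnth_mktuple !eqxx mulr1 add0r.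
  have cl : continuous (fun s : R => x0 + s *: delta_mx 0 k).
    move=> s; apply: cvgD; first exact: cvg_cst.
    by apply: cvgZr_tmp; exact: cvg_id.
  under eq_integral do rewrite /= xE.
  apply: (@integral0_derive1 (fun s => g (x0 + s *: delta_mx 0 k))
    (fun s => h (x0 + s *: delta_mx 0 k))).
  + by move=> s; exact: (continuous_comp (cl s) (ch _)).
  + by move=> s; apply/is_derive_lineP; exact: dg.
  + by move=> s s1; apply: (gh0 _ k); rewrite xkE.
Qed.

End compactly_supported_derivative.

(** * The defining function of the ball *)

Section ball_gap.
Context {R : realType} {d : nat}.
Implicit Types x : 'rV[R]_d.

Definition gap x : R := 1 - \sum_(i < d) x 0 i ^+ 2.

Lemma gapE x : 1 - enorm x ^+ 2 = gap x.
Proof. by rewrite /enorm sqr_sqrtr ?sumr_ge0// => i _; exact: sqr_ge0. Qed.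

Lemma gap_le1 x : gap x <= 1.
Proof. by rewrite gerBl sumr_ge0// => i _; exact: sqr_ge0. Qed.

Lemma unit_ballE : unit_ball = [set x | 0 < gap x].
Proof.
apply/funext => x; apply/propext; rewrite /unit_ball /= -gapE subr_gt0.
by rewrite expr_lt1// sqrtr_ge0.
Qed.

Lemma gap_le0 x i : 1 <= `|x 0 i| -> gap x <= 0.
Proof.
move=> x1; rewrite subr_le0 (bigD1 i)//=.
rewrite -[leLHS]addr0 lerD//; last by rewrite sumr_ge0// => j _; exact: sqr_ge0.
by rewrite -real_normK ?num_real// expr_ge1.
Qed.

Lemma coord_gap x i : 0 < gap x -> `|x 0 i| <= 1.
Proof.
by move=> x0; rewrite leNgt; apply/negP => /ltW/gap_le0; rewrite leNgt x0.
Qed.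

Lemma continuous_coord i : continuous (fun x => x 0 i).
Proof. exact: coord_continuous. Qed.

Lemma continuous_gap : continuous gap.
Proof.
have cs : continuous (fun x : 'rV[R]_d => \sum_(i < d) x 0 i ^+ 2).
  apply: continuous_big => [|i _ x]; first exact: add_continuous.
  by apply: continuousM; exact: continuous_coord.
by move=> x; apply: continuousB; [exact: cst_continuous|exact: cs].
Qed.

Lemma open_unit_ball : open (@unit_ball R d).
Proof.
rewrite unit_ballE; apply: (@open_comp _ _ gap [set r | 0 < r]) => [x _|].
  exact: continuous_gap.
exact: open_gt.
Qed.

Lemma is_derive_coord x k i :
  is_derive x (delta_mx 0 k) (fun y => y 0 i) (i == k)%:R.
Proof.
have E : (fun h : R => h^-1 *: (((fun y => y 0 i) \o shift x) (h *: delta_mx 0 k)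
    - x 0 i)) @ 0^' --> ((i == k)%:R : R).
  apply: cvg_near_cst; near=> h.
  rewrite /= !mxE addrK eqxx/= /GRing.scale/= mulrA mulVf ?mul1r//.
  by near: h; exact: nbhs_dnbhs_neq.
split; first by apply/cvg_ex; exists (i == k)%:R.
exact/cvg_lim.
Unshelve. all: by end_near. Qed.

Lemma is_derive_gap x k : is_derive x (delta_mx 0 k) gap (- 2 * x 0 k).
Proof.
rewrite (_ : gap = cst 1 - \sum_(i < d) (fun y : 'rV[R]_d => y 0 i) ^+ 2); last first.
  by apply/funext => y; rewrite /gap /= !fctE fct_sumE.
apply: is_derive_eq.
  apply: is_deriveB; apply: is_derive_sum => i.
  by apply: is_deriveX; exact: is_derive_coord.
rewrite sub0r mulNr; congr (- _).
rewrite (bigD1 k)//= big1 ?addr0 => [|i /negPf ->]; last by rewrite scaler0.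
by rewrite eqxx /GRing.scale/= mulr1 expr1.
Qed.

(** The one-variable chain rule on the line through [x] in direction [k]; [x] is rewritten as the
    point of parameter 0 on it. *)
Lemma is_derive_comp_gap (p : R -> R) (l : R) x k :
  is_derive (gap x) (1 : R) p l ->
  is_derive x (delta_mx 0 k) (p \o gap) (l * (- 2 * x 0 k)).
Proof.
move=> dp; have lineP (g : 'rV[R]_d -> R) :=
  @is_derive_lineP R d g x (delta_mx 0 k) 0.
rewrite -[x in is_derive x]addr0 -(scale0r (delta_mx 0 k)).
apply/lineP; apply: is_derive1_comp; first by rewrite scale0r addr0.
by apply/lineP; rewrite scale0r addr0; exact: is_derive_gap.
Qed.

End ball_gap.

(** * Cutoffs of the powers *)

Section cutoff.
Context {R : realType}.
Implicit Types e b s y : R.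

Lemma is_derive_sqr_posp y :
  is_derive y (1 : R) (fun z => Num.max z 0 ^+ 2) (2 * Num.max y 0).
Proof.
have [y0|y0|->] := ltgtP y 0.
- rewrite mulr0; apply: (near_eq_is_derive (f := cst 0)) => //.
  near=> z; rewrite max_r ?expr0n//.
  by apply/ltW; near: z; exact: lt_nbhsl.
- apply: (near_eq_is_derive (f := (@id R) ^+ 2)).
    near=> z; rewrite max_l//.
    by apply/ltW; near: z; exact: lt_nbhsr.
  apply: is_derive_eq.
  by rewrite expr1 /GRing.scale/= mulr1.
- rewrite mulr0.
  (* At the kink the difference quotient of the squared positive part is the positive part of [h],
     which tends to 0. Without the square the one-sided slopes would differ. *)
  have E : (fun h : R => h^-1 *: (((fun z : R => Num.max z 0 ^+ 2) \o shift 0) (h *: 1)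
      - Num.max 0 0 ^+ 2)) = (fun h => Num.max h 0).
    apply/funext => h; rewrite /= /GRing.scale/= mulr1 addr0 maxxx expr0n subr0.
    have [h0|h0] := leP h 0; first by rewrite expr0n mulr0.
    by rewrite expr2 mulrA mulVf ?mul1r// gt_eqF.
  have c : (fun h : R => Num.max h 0) @ 0^' --> (0 : R).
    rewrite -[X in _ --> X](maxxx (0 : R)).
    apply: cvg_within_filter.
    by apply: continuous_max; [exact: cvg_id|exact: cvg_cst].
  apply: DeriveDef.
    by rewrite /derivable E; apply/cvg_ex; exists 0.
  by rewrite /derive E; exact/cvg_lim.
Unshelve. all: by end_near. Qed.

(** The square makes the cutoff C^1 at [s = e]. The exponent [b - 2] compensates it, so that the
    limit is [s^b] and, since [0 <= max(s - e, 0) <= s], the cutoff and its derivative are bounded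
    by multiples of [s^b] and [s^(b-1)] independent of [e]. *)
Definition cutoff e b s := Num.max (s - e) 0 ^+ 2 * s `^ (b - 2).

Definition dcutoff e b s :=
  2 * Num.max (s - e) 0 * s `^ (b - 2) +
  Num.max (s - e) 0 ^+ 2 * ((b - 2) * s `^ (b - 3)).

Lemma cutoff_le0 e b s : s <= e -> cutoff e b s = 0.
Proof. by move=> se; rewrite /cutoff max_r ?subr_le0// expr0n mul0r. Qed.

Lemma dcutoff_le0 e b s : s <= e -> dcutoff e b s = 0.
Proof.
by move=> se; rewrite /dcutoff max_r ?subr_le0// expr0n mulr0 !mul0r addr0.
Qed.

Lemma is_derive_cutoff e b s : 0 < e ->
  is_derive s (1 : R) (cutoff e b) (dcutoff e b s).
Proof.
move=> e0; have [se|es] := ltP s e.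
  rewrite dcutoff_le0 ?ltW//; apply: (near_eq_is_derive (f := cst 0)) => //.
  near=> z; rewrite cutoff_le0//.
  by apply/ltW; near: z; exact: lt_nbhsl.
have s0 : 0 < s by exact: lt_le_trans es.
have d1 : is_derive s (1 : R) (fun z => Num.max (z - e) 0 ^+ 2)
    (2 * Num.max (s - e) 0 * 1).
  apply: (@is_derive1_comp _ (fun z : R => Num.max z 0 ^+ 2) (fun z => z - e)).
    exact: is_derive_sqr_posp.
  by apply: is_derive_eq; rewrite oppr0 addr0.
have d2 := is_derive1_powR (b - 2) s0.
rewrite /cutoff; apply: is_derive_eq (is_deriveM d1 d2) _.
rewrite /dcutoff /GRing.scale/= mulr1 addrC (_ : b - 2 - 1 = b - 3); last by ring.
by rewrite [X in X + _]mulrC.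
Unshelve. all: by end_near. Qed.

Lemma continuous_powR b s : 0 < s -> {for s, continuous (fun z : R => z `^ b)}.
Proof.
move=> s0; apply: differentiable_continuous; apply/derivable1_diffP.
by have [] := is_derive1_powR b s0.
Qed.

Lemma continuous_dcutoff e b : 0 < e -> continuous (dcutoff e b).
Proof.
move=> e0 s; have [se|es] := ltP s e.
  rewrite /continuous_at dcutoff_le0 ?ltW//; apply: cvg_near_cst; near=> z.
  rewrite dcutoff_le0//.
  by apply/ltW; near: z; exact: lt_nbhsl.
have s0 : 0 < s by exact: lt_le_trans es.
have cm : {for s, continuous (fun z => Num.max (z - e) 0)}.
  apply: (continuous_max (f := fun z => z - e) (g := cst 0)).
    by apply: cvgB; [exact: cvg_id|exact: cvg_cst].
  exact: cvg_cst.
apply: cvgD; apply: cvgM.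
- by apply: cvgM => //; exact: cvg_cst.
- exact: continuous_powR.
- by apply: cvgM.
- by apply: cvgM; [exact: cvg_cst|exact: continuous_powR].
Unshelve. all: by end_near. Qed.

Lemma powR_sqr b s : 0 < s -> s ^+ 2 * s `^ (b - 2) = s `^ b.
Proof.
move=> s0; rewrite -powR_mulrn ?ltW// -powRD ?(gt_eqF s0) ?implybT//.
by congr (_ `^ _); ring.
Qed.

Lemma mulr_powR c s : 0 < s -> s * s `^ c = s `^ (c + 1).
Proof.
by move=> s0; rewrite powRD ?(gt_eqF s0) ?implybT// powRr1 ?ltW// mulrC.
Qed.

Lemma powR_sub2 b s : 0 < s -> s * s `^ (b - 2) = s `^ (b - 1).
Proof. by move=> /mulr_powR ->; congr (_ `^ _); ring. Qed.

Lemma powR_sub3 b s : 0 < s -> s ^+ 2 * s `^ (b - 3) = s `^ (b - 1).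
Proof.
move=> s0; rewrite -powR_mulrn ?ltW// -powRD ?(gt_eqF s0) ?implybT//.
by congr (_ `^ _); ring.
Qed.

Lemma posp_itv e s : 0 < e -> 0 < s -> 0 <= Num.max (s - e) 0 <= s.
Proof. by move=> e0 s0; rewrite le_max lexx orbT ge_max gerBl !ltW. Qed.

Lemma cutoff_itv e b s : 0 < e -> 0 < s -> 0 <= cutoff e b s <= s `^ b.
Proof.
move=> e0 s0; have /andP[m0 ms] := posp_itv e0 s0.
rewrite mulr_ge0 ?powR_ge0 ?sqr_ge0//= -powR_sqr//.
by rewrite ler_wpM2r ?powR_ge0// lerXn2r// nnegrE ltW.
Qed.

Lemma dcutoff_bound e b s : 0 < e -> 0 < s ->
  `|dcutoff e b s| <= (2 + `|b - 2|) * s `^ (b - 1).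
Proof.
move=> e0 s0; have /andP[m0 ms] := posp_itv e0 s0.
rewrite mulrDl (le_trans (ler_normD _ _))// lerD//.
  rewrite ger0_norm ?mulr_ge0 ?powR_ge0// -powR_sub2// mulrA.
  by rewrite ler_wpM2r ?powR_ge0// ler_pM2l.
rewrite !normrM [leLHS]mulrCA ler_wpM2l// -powR_sub3//.
rewrite !ger0_norm ?powR_ge0//.
by rewrite -expr2 ler_wpM2r ?powR_ge0// lerXn2r// nnegrE ltW.
Qed.

(** With [m = max(s - e, 0)] the derivative factors as [m s^(b-3) (2 (s - m) + b m)], and [m <= s].
    This sign is what permits Fatou's lemma before any dominating function is known. *)
Lemma dcutoff_ge0 e b s : 0 < e -> 0 < s -> 0 <= b -> 0 <= dcutoff e b s.
Proof.
move=> e0 s0 b0; have /andP[m0 ms] := posp_itv e0 s0.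
rewrite /dcutoff; set m := Num.max _ _ in m0 ms *.
have -> : s `^ (b - 2) = s * s `^ (b - 3).
  by rewrite mulr_powR//; congr (_ `^ _); ring.
have -> : 2 * m * (s * s `^ (b - 3)) + m ^+ 2 * ((b - 2) * s `^ (b - 3)) =
  m * s `^ (b - 3) * (2 * (s - m) + b * m) by ring.
by rewrite !mulr_ge0 ?powR_ge0// addr_ge0// mulr_ge0// subr_ge0.
Qed.

Lemma cvg_posp s : 0 < s ->
  (fun n => Num.max (s - n.+1%:R^-1) 0) @ \oo --> s.
Proof.
move=> s0.
have c : (fun n => s - n.+1%:R^-1) @ \oo --> s.
  rewrite -[X in _ --> X]subr0.
  by apply: cvgB; [exact: cvg_cst|exact: cvg_harmonic].
apply: (cvg_trans _ c); apply: near_eq_cvg; near=> n; rewrite max_l// subr_ge0.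
apply/ltW; near: n.
exact: near_infty_natSinv_lt (PosNum s0).
Unshelve. all: by end_near. Qed.

Lemma cvg_cutoff b s : 0 < s ->
  (fun n => cutoff n.+1%:R^-1 b s) @ \oo --> s `^ b.
Proof.
move=> s0; rewrite -powR_sqr//; apply: cvgMr_tmp.
by apply: cvgM; exact: cvg_posp.
Qed.

Lemma cvg_dcutoff b s : 0 < s ->
  (fun n => dcutoff n.+1%:R^-1 b s) @ \oo --> b * s `^ (b - 1).
Proof.
move=> s0.
rewrite (_ : b * _ = 2 * s * s `^ (b - 2) + s ^+ 2 * ((b - 2) * s `^ (b - 3))).
  apply: cvgD; apply: cvgMr_tmp.
    by apply: cvgMl_tmp; exact: cvg_posp.
  by apply: cvgM; exact: cvg_posp.
by rewrite -mulrA powR_sub2// mulrCA powR_sub3//; ring.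
Qed.

End cutoff.

(** * Bounded continuous functions on the ball and cut-off integration by parts *)

Section ball_integral.
Context {R : realType} {d : nat}.
Local Notation Rd := 'rV[R]_d.
Local Notation mu := (lebesgue_tuple d : {measure set (d.-tuple (measurableTypeR R)) -> \bar R}).
Local Notation ballT := (row_of_tuple @^-1` (@unit_ball R d)).
Implicit Types (f F : Rd -> R) (a b : R) (k : 'I_d).

Lemma measurable_ballT : measurable ballT.
Proof. by apply: measurable_open_rV; exact: open_unit_ball. Qed.

Lemma lebesgue_ballT_lty : (mu ballT < +oo)%E.
Proof.
apply: le_lt_trans (lebesgue_cube_lty d); apply: le_measure; rewrite ?inE//.
- exact: measurable_ballT.
- exact: measurable_cube.
- move=> t; rewrite unit_ballE /= => t0 i /=.
  by rewrite in_itv/= -ler_norml; have := coord_gap i t0; rewrite mxE.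
Qed.

Definition ball_cont f := {in @unit_ball R d, continuous f}.

Definition ball_bcont f :=
  ball_cont f /\ exists C, forall x, unit_ball x -> `|f x| <= C.

Lemma ball_bcont_cst (c : R) : ball_bcont (cst c).
Proof. by split; [move=> x _; exact: cst_continuous|exists `|c|]. Qed.

Lemma ball_bcont_coord k : ball_bcont (fun x => x 0 k).
Proof.
split; first by move=> x _; exact: continuous_coord.
by exists 1 => x; rewrite unit_ballE; exact: coord_gap.
Qed.

Lemma ball_bcontM f F : ball_bcont f -> ball_bcont F -> ball_bcont (f \* F).
Proof.
move=> [cf [C hC]] [cF [D hD]]; split.
  by move=> x Bx; apply: continuousM; [exact: cf|exact: cF].
exists (C * D) => x Bx; rewrite normrM ler_pM//; [exact: hC|exact: hD].
Qed.

Lemma ball_bcontD f F : ball_bcont f -> ball_bcont F -> ball_bcont (f \+ F).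
Proof.
move=> [cf [C hC]] [cF [D hD]]; split.
  by move=> x Bx; apply: continuousD; [exact: cf|exact: cF].
exists (C + D) => x Bx; rewrite (le_trans (ler_normD _ _))// lerD//.
  exact: hC.
exact: hD.
Qed.

Lemma ball_bcontN f : ball_bcont f -> ball_bcont (\- f).
Proof.
move=> [cf [C hC]]; split; first by move=> x Bx; apply: continuousN; exact: cf.
by exists C => x Bx; rewrite normrN; exact: hC.
Qed.

Lemma ball_bcontB f F : ball_bcont f -> ball_bcont F -> ball_bcont (f \- F).
Proof. by move=> bf bF; apply: ball_bcontD => //; exact: ball_bcontN. Qed.

(** On the ball the gap takes its values in the compact interval [0, 1]. This serves the cutoffs,
    which are continuous on the whole line, unlike a power of negative exponent. *)
Lemma ball_bcont_comp_gap (p : R -> R) : continuous p -> ball_bcont (p \o gap).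
Proof.
move=> cp; split.
  by move=> x _; apply: continuous_comp; [exact: continuous_gap|exact: cp].
have /compact_bounded[M [_ hM]] :=
  continuous_compact (continuous_subspaceT cp) (@segment_compact R 0 1).
exists (`|M| + 1) => x; rewrite unit_ballE /= => x0.
apply: (hM (`|M| + 1)); first by rewrite ltr_pwDr// ler_norm.
by exists (gap x) => //=; rewrite in_itv/= (ltW x0) gap_le1.
Qed.

Lemma ball_cont_powR_gap a : ball_cont (fun x => gap x `^ a).
Proof.
move=> x; rewrite inE unit_ballE /= => x0.
apply: (@continuous_comp _ _ _ gap (fun s => s `^ a)).
  exact: continuous_gap.
exact: continuous_powR.
Qed.

Lemma measurable_fun_ball f : ball_cont f ->
  measurable_fun ballT (EFin \o (f \o row_of_tuple)).
Proof.
move=> cf; apply/measurable_EFinP.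
by apply: measurable_fun_rV => //; exact: open_unit_ball.
Qed.

Lemma integrable_ball_bcont f : ball_bcont f ->
  mu.-integrable ballT (EFin \o (f \o row_of_tuple)).
Proof.
move=> [cf [C hC]].
apply: measurable_bounded_integrable.
- exact: measurable_ballT.
- exact: lebesgue_ballT_lty.
- by apply: measurable_fun_rV => //; exact: open_unit_ball.
- exists C; split; first exact: num_real.
  by move=> M CM t Bt; apply: le_trans (ltW CM); exact: hC.
Qed.

Definition ball_C1 f := ball_bcont f /\
  forall k, (forall x, unit_ball x -> derivable f x (delta_mx 0 k)) /\
    ball_bcont ('D_(delta_mx 0 k) f).

(** The integrand is [d_k (p(gap) f)], since [d_k gap = -2 x_k]. Nothing is known of [f] off the
    ball, but [p] and [dp] vanish where the gap is at most [e], so the product and its derivative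
    are zero there and continue to all of R^d. *)
Lemma integral0_cutoff_div f k (p dp : R -> R) (e : R) : 0 < e ->
  (forall s, s <= e -> p s = 0 /\ dp s = 0) -> continuous dp ->
  (forall s, is_derive s (1 : R) p (dp s)) ->
  ball_cont f -> (forall x, unit_ball x -> derivable f x (delta_mx 0 k)) ->
  ball_cont ('D_(delta_mx 0 k) f) ->
  (\int[mu]_(t in ballT) (p (gap (row_of_tuple t)) *
      'D_(delta_mx 0 k) f (row_of_tuple t) -
    2 * row_of_tuple t 0 k * dp (gap (row_of_tuple t)) * f (row_of_tuple t))%:E
   = 0)%E.
Proof.
move=> e0 p0 cdp hp cf df cDf.
pose g x := p (gap x) * f x.
pose h x := p (gap x) * 'D_(delta_mx 0 k) f x - 2 * x 0 k * dp (gap x) * f x.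
have gh0 x : gap x <= e -> g x = 0 /\ h x = 0.
  by move=> /p0[px dpx]; rewrite /g /h px dpx !(mul0r, mulr0) subr0.
have near0 (x : Rd) : gap x < e -> \forall y \near x, gap y <= e.
  move=> xe; near=> y; apply/ltW; near: y.
  exact: (@continuous_gap R d x _ (lt_nbhsl xe)).
have cp : continuous p.
  move=> s; apply: differentiable_continuous; apply/derivable1_diffP.
  by have [] := hp s.
have ball_e (x : Rd) : e <= gap x -> unit_ball x.
  by rewrite unit_ballE /=; exact: lt_le_trans.
transitivity (\int[mu]_t (h (row_of_tuple t))%:E)%E.
  rewrite integral_mkcond; apply: eq_integral => t _; rewrite patchE.
  case: ifPn => //; rewrite notin_setE /= => tB.
  rewrite (gh0 _ _).2//; apply/ltW; rewrite ltNge; apply/negP => /ball_e.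
  exact: tB.
apply: (@integral0_partial _ _ k g h).
(* Where the gap is below [e] the function is locally zero; where it is at least [e] the point lies
   in the open ball and the product rule applies. The two cases cover R^d. *)
- move=> x; have [xe|ex] := ltP (gap x) e.
    have hx0 : \forall y \near x, h y = 0.
      by apply: filterS (near0 _ xe) => y /gh0[].
    by rewrite /continuous_at (gh0 _ (ltW xe)).2; exact: (@cvg_near_cst _ R 0 h (nbhs x) _ hx0).
  have Bx : x \in unit_ball by rewrite inE; exact: ball_e.
  have cpx : {for x, continuous (p \o gap)}.
    by apply: continuous_comp; [exact: continuous_gap|exact: cp].
  have cdpx : {for x, continuous (dp \o gap)}.
    by apply: continuous_comp; [exact: continuous_gap|exact: cdp].
  have -> : h = (p \o gap) * 'D_(delta_mx 0 k) f -
      cst 2 * (fun y : Rd => y 0 k) * (dp \o gap) * f by [].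
 
  apply: continuousB; apply: continuousM; [exact: cpx|exact: cDf| |exact: cf].
  apply: continuousM => //; apply: continuousM; first exact: cst_continuous.
  exact: continuous_coord.
- move=> x; have [xe|ex] := ltP (gap x) e.
    rewrite (gh0 _ (ltW xe)).2; apply: (near_eq_is_derive (f := cst 0)) => //.
    by apply: filterS (near0 _ xe) => y /gh0[->].
  have dfx : is_derive x (delta_mx 0 k) f ('D_(delta_mx 0 k) f x).
    by apply: DeriveDef => //; exact/df/ball_e.
  have dpx := is_derive_comp_gap k (hp (gap x)).
  apply: is_derive_eq (is_deriveM dpx dfx) _.
  by rewrite /h /GRing.scale/=; ring.
- by move=> x i /gap_le0 xi; apply: gh0; exact: le_trans (ltW e0).
Unshelve. all: by end_near. Qed.

End ball_integral.

(** * Integrability of the weight *)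

Section weighted_integral.
Context {R : realType} {d : nat}.
Local Notation Rd := 'rV[R]_d.
Local Notation mu := (lebesgue_tuple d : {measure set (d.-tuple (measurableTypeR R)) -> \bar R}).
Local Notation ballT := (row_of_tuple @^-1` (@unit_ball R d)).
Implicit Types (f F : Rd -> R) (a b : R) (k : 'I_d).

Let mball := @measurable_ballT R d.

Lemma ball_contM f F : ball_cont f -> ball_cont F -> ball_cont (f \* F).
Proof. by move=> cf cF x Bx; apply: continuousM; [exact: cf|exact: cF]. Qed.

Lemma ball_gap_gt0 (x : Rd) : unit_ball x -> 0 < gap x.
Proof. by rewrite unit_ballE. Qed.

Lemma continuous_cutoff e b : 0 < e -> continuous (@cutoff R e b).
Proof.
move=> e0 s; apply: differentiable_continuous; apply/derivable1_diffP.
by have [] := is_derive_cutoff b s e0.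
Qed.

Lemma integral0_cutoff f k b n :
  ball_cont f -> (forall x, unit_ball x -> derivable f x (delta_mx 0 k)) ->
  ball_cont ('D_(delta_mx 0 k) f) ->
  (\int[mu]_(t in ballT) (cutoff n.+1%:R^-1 b (gap (row_of_tuple t)) *
      'D_(delta_mx 0 k) f (row_of_tuple t) -
    2 * row_of_tuple t 0 k * dcutoff n.+1%:R^-1 b (gap (row_of_tuple t)) *
    f (row_of_tuple t))%:E = 0)%E.
Proof.
have e0 : 0 < n.+1%:R^-1 :> R by rewrite invr_gt0.
apply: (integral0_cutoff_div e0).
- by move=> s se; rewrite cutoff_le0 ?dcutoff_le0.
- exact: continuous_dcutoff.
- by move=> s; exact: is_derive_cutoff.
Qed.

(* Integration by parts against [x_k] itself shows that [x_k^2 (1-|x|^2)^a] has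
   finite integral, uniformly in the cutoff parameter. *)
Lemma integrable_coord_powR_gap a k : -1 < a ->
  mu.-integrable ballT (fun t =>
    (row_of_tuple t 0 k ^+ 2 * gap (row_of_tuple t) `^ a)%:E).
Proof.
move=> a1; pose b := a + 1.
have b0 : 0 < b by rewrite /b; lra.
pose w (x : Rd) := 2 * (x 0 k * x 0 k).
have bw : ball_bcont w.
  by apply: ball_bcontM (ball_bcont_cst 2) _; apply: ball_bcontM;
    exact: ball_bcont_coord.
pose u n (x : Rd) := w x * dcutoff n.+1%:R^-1 b (gap x).
pose v n (x : Rd) := cutoff n.+1%:R^-1 b (gap x).
have e0 n : 0 < n.+1%:R^-1 :> R by rewrite invr_gt0.
have bu n : ball_bcont (u n).
  apply: ball_bcontM bw _; apply: (ball_bcont_comp_gap (p := dcutoff _ b)).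
  exact: continuous_dcutoff.
have bv n : ball_bcont (v n).
  by apply: (ball_bcont_comp_gap (p := cutoff _ b)); exact: continuous_cutoff.
have w0 x : 0 <= w x by rewrite mulr_ge0// -expr2 sqr_ge0.
have u0 n (x : Rd) : unit_ball x -> 0 <= u n x.
  by move=> /ball_gap_gt0 x0; apply: mulr_ge0 => //; apply: dcutoff_ge0 => //; exact: ltW.
(* With [f = x_k] the vanishing integral says that [v n] and [u n] have equal integrals, and
   [v n <= gap^b <= 1] because [b > 0]. *)
have uv n : (\int[mu]_(t in ballT) (u n (row_of_tuple t))%:E <= mu ballT)%E.
  have cD (x : Rd) : 'D_(delta_mx 0 k) (fun x : Rd => x 0 k) x = 1.
    by have [_ ->] := is_derive_coord x k k; rewrite eqxx.
  have vu0 : (\int[mu]_(t in ballT) ((v n \- u n) (row_of_tuple t))%:E = 0)%E.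
    rewrite -[RHS](@integral0_cutoff (fun x : Rd => x 0 k) k b n).
    - apply: eq_integral => t _; congr (_%:E).
      by rewrite cD /u /v /w /=; ring.
    - exact: (ball_bcont_coord k).1.
    - by move=> x _; have [] := is_derive_coord x k k.
    - by rewrite (funext cD); exact: (ball_bcont_cst 1).1.
  have <- : (\int[mu]_(t in ballT) (v n (row_of_tuple t))%:E =
             \int[mu]_(t in ballT) (u n (row_of_tuple t))%:E)%E.
    rewrite -[RHS]add0e -vu0 -integralD//; last 2 first.
    - exact: (integrable_ball_bcont (ball_bcontB (bv n) (bu n))).
    - exact: (integrable_ball_bcont (bu n)).
    by apply: eq_integral => t _; rewrite -EFinD/= subrK.
  rewrite -[leRHS]mul1e -integral_cst//; apply: ge0_le_integral => //.
  - move=> t /ball_gap_gt0 t0; rewrite lee_fin.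
    by have /andP[] := cutoff_itv b (e0 n) t0.
  - exact: (measurable_fun_ball (bv n).1).
  - move=> t /ball_gap_gt0 t0; rewrite lee_fin.
    have /andP[_ /le_trans] := cutoff_itv b (e0 n) t0; apply.
    rewrite -[leRHS](powRr0 (gap (row_of_tuple t))).
    by apply: ger_powR; [rewrite t0 gap_le1|exact: ltW].
have mF : measurable_fun ballT
    (fun t => (w (row_of_tuple t) * (b * gap (row_of_tuple t) `^ a))%:E).
  apply: (measurable_fun_ball (f := fun x => w x * (b * gap x `^ a))).
  apply: ball_contM bw.1 _; apply: ball_contM; first exact: (ball_bcont_cst b).1.
  exact: ball_cont_powR_gap.
have iF : mu.-integrable ballT
    (fun t => (w (row_of_tuple t) * (b * gap (row_of_tuple t) `^ a))%:E).
  apply/integrableP; split=> //.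
  apply: le_lt_trans (@lebesgue_ballT_lty R d).
  (* The functions [u n] are nonnegative and converge pointwise to the target, so Fatou carries the
     uniform bound over to the limit. *)
  rewrite (eq_integral (fun t => limn_einf (fun n => (u n (row_of_tuple t))%:E))).
    apply: (le_trans (fatou _ _ _ _)) => //.
    - by move=> n; exact: (measurable_fun_ball (bu n).1).
    - by move=> n t Bt; rewrite lee_fin u0.
    rewrite limn_einf_lim; apply: lime_le; first exact: is_cvg_einfs.
    apply: nearW => n; apply: le_trans (uv n).
    by apply: ereal_inf_lbound; exists n => /=.
  move=> t; rewrite inE => /ball_gap_gt0 t0.
  have cu : (fun n => (u n (row_of_tuple t))%:E) @ \oo -->
     (w (row_of_tuple t) * (b * gap (row_of_tuple t) `^ a))%:E.
    apply: cvg_EFin; first by apply: nearW.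
    apply: cvgMl_tmp; have := @cvg_dcutoff R b _ t0.
    by rewrite (_ : b - 1 = a)// /b addrK.
  rewrite is_cvg_limn_einfE; last by apply/cvg_ex; eexists; exact: cu.
  rewrite (cvg_lim _ cu)// gee0_abs// lee_fin mulr_ge0// mulr_ge0 ?powR_ge0//.
  exact: ltW.
move: (integrableZl mball (2 * b)^-1 iF); apply: eq_integrable => // t _.
rewrite -EFinM; congr (_%:E); rewrite /w; field.
by rewrite gt_eqF.
Qed.

(** As [gap + |x|^2 = 1], the weight splits into [gap^(a+1)], bounded because [a + 1 > 0], and the
    terms [x_k^2 gap^a] already treated. *)
Lemma integrable_powR_gap a : -1 < a ->
  mu.-integrable ballT (fun t => (gap (row_of_tuple t) `^ a)%:E).
Proof.
move=> a1.
have ig : mu.-integrable ballT (fun t => (gap (row_of_tuple t) `^ (a + 1))%:E).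
  apply: (integrable_ball_bcont (f := fun x => gap x `^ (a + 1))).
  split; first exact: ball_cont_powR_gap.
  exists 1 => x /ball_gap_gt0 x0; rewrite ger0_norm ?powR_ge0//.
  rewrite -[leRHS](powRr0 (gap x)).
  by apply: ger_powR; [rewrite x0 gap_le1|lra].
have is' : mu.-integrable ballT (fun t => \sum_(k < d)
    (row_of_tuple t 0 k ^+ 2 * gap (row_of_tuple t) `^ a)%:E)%E.
  apply: integrable_sum => // k _; exact: integrable_coord_powR_gap.
move: (integrableD mball ig is'); apply: eq_integrable => // t.
rewrite inE => /ball_gap_gt0 t0 /=.
rewrite sumEFin -EFinD; congr (_%:E).
rewrite -mulr_suml -mulr_powR// -mulrDl.
by rewrite {1}/gap subrK mul1r.
Qed.

Lemma integrable_weighted a f : -1 < a -> ball_bcont f ->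
  mu.-integrable ballT (fun t =>
    (f (row_of_tuple t) * gap (row_of_tuple t) `^ a)%:E).
Proof.
move=> a1 [cf [C hC]].
apply: (le_integrable mball _ _ (integrableZl mball C (integrable_powR_gap a1))).
  apply: (measurable_fun_ball (f := f \* (fun x => gap x `^ a))).
  by apply: ball_contM => //; exact: ball_cont_powR_gap.
move=> t Bt; rewrite -EFinM !abse_EFin lee_fin !normrM ler_wpM2r//.
by rewrite (le_trans (hC _ Bt))// ler_norm.
Qed.

End weighted_integral.

(** * Integration by parts with the true weight *)

Section integration_by_parts.
Context {R : realType} {d : nat}.
Local Notation Rd := 'rV[R]_d.
Local Notation mu := (lebesgue_tuple d : {measure set (d.-tuple (measurableTypeR R)) -> \bar R}).
Local Notation ballT := (row_of_tuple @^-1` (@unit_ball R d)).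
Implicit Types (f F : Rd -> R) (a b : R) (k : 'I_d).

Let mball := @measurable_ballT R d.

Lemma ball_contB f F : ball_cont f -> ball_cont F -> ball_cont (f \- F).
Proof. by move=> cf cF x Bx; apply: continuousB; [exact: cf|exact: cF]. Qed.

(** The ball is open, so agreement on it is agreement near each of its points. Formulas for
    derivatives, valid only inside the ball, can thus be substituted in continuity statements. *)
Lemma eq_ball_cont f F : (forall x, unit_ball x -> f x = F x) ->
  ball_cont f -> ball_cont F.
Proof.
move=> fF cf x; rewrite inE => Bx.
have nfF : \forall y \near x, f y = F y.
  by near do apply: fF; apply: open_nbhs_nbhs; split => //; exact: open_unit_ball.
rewrite /continuous_at -fF//; apply: cvg_trans (cf x (mem_set Bx)).
exact: near_eq_cvg nfF.
Unshelve. all: by end_near. Qed.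

Lemma eq_ball_bcont f F : (forall x, unit_ball x -> f x = F x) ->
  ball_bcont f -> ball_bcont F.
Proof.
move=> fF [cf [C hC]]; split; first exact: eq_ball_cont cf.
by exists C => x Bx; rewrite -fF// hC.
Qed.

Lemma ball_C1_coord k : ball_C1 (fun x : Rd => x 0 k).
Proof.
split; first exact: ball_bcont_coord.
move=> i; split; first by move=> x _; have [] := is_derive_coord x i k.
apply: eq_ball_bcont (ball_bcont_cst (k == i)%:R) => x _.
by have [_ ->] := is_derive_coord x i k.
Qed.

Lemma ball_C1_cst (c : R) : ball_C1 (cst c : Rd -> R).
Proof.
split; first exact: ball_bcont_cst.
move=> i; split; first by move=> x _; exact: derivable_cst.
by apply: eq_ball_bcont (ball_bcont_cst 0) => x _; rewrite derive_cst.
Qed.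

Lemma ball_C1M f F : ball_C1 f -> ball_C1 F -> ball_C1 (f \* F).
Proof.
move=> [bf df] [bF dF]; split; first exact: ball_bcontM.
move=> k; have [df1 df2] := df k; have [dF1 dF2] := dF k; split.
  by move=> x Bx; apply: derivableM; [exact: df1|exact: dF1].
apply: eq_ball_bcont (ball_bcontD (ball_bcontM bf dF2) (ball_bcontM bF df2)).
by move=> x Bx /=; rewrite deriveM//; [exact: df1|exact: dF1].
Qed.

Lemma ball_C1D f F : ball_C1 f -> ball_C1 F -> ball_C1 (f \+ F).
Proof.
move=> [bf df] [bF dF]; split; first exact: ball_bcontD.
move=> k; have [df1 df2] := df k; have [dF1 dF2] := dF k; split.
  by move=> x Bx; apply: derivableD; [exact: df1|exact: dF1].
apply: eq_ball_bcont (ball_bcontD df2 dF2).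
by move=> x Bx /=; rewrite deriveD//; [exact: df1|exact: dF1].
Qed.

Lemma integral0_dominated a (F_ : nat -> Rd -> R) F (C : R) : -1 < a ->
  (forall n, ball_cont (F_ n)) -> ball_cont F ->
  (forall x, unit_ball x -> F_ ^~ x @ \oo --> F x) ->
  (forall n x, unit_ball x -> `|F_ n x| <= C * gap x `^ a) ->
  (forall n, \int[mu]_(t in ballT) (F_ n (row_of_tuple t))%:E = 0)%E ->
  (\int[mu]_(t in ballT) (F (row_of_tuple t))%:E = 0)%E.
Proof.
move=> a1 cF_ cF F_F F_C F_0.
have F_F' : {ae mu, forall t, ballT t ->
    (fun n => (F_ n (row_of_tuple t))%:E) @ \oo --> (F (row_of_tuple t))%:E}.
  by apply: aeW => t Bt; apply: cvg_EFin; [exact: nearW|exact: F_F].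
have F_C' : {ae mu, forall t n, ballT t ->
    (`|(F_ n (row_of_tuple t))%:E| <= (C * gap (row_of_tuple t) `^ a)%:E)%E}.
  by apply: aeW => t n Bt; rewrite abse_EFin lee_fin; exact: F_C.
have [_ _] := dominated_convergence mball
  (fun n => measurable_fun_ball (cF_ n)) (measurable_fun_ball cF)
  F_F' (integrableZl mball C (integrable_powR_gap a1)) F_C'.
rewrite /= (_ : (fun n => _) = cst 0%E); last by apply/funext => n; exact: F_0.
by move/cvg_lim => <-//; rewrite lim_cst.
Qed.

Definition wint a F : R :=
  \int[mu]_(t in ballT) (F (row_of_tuple t) * gap (row_of_tuple t) `^ a).

Lemma eq_wint a f F : (forall x, unit_ball x -> f x = F x) ->
  wint a f = wint a F.
Proof.
by move=> fF; apply: eq_Rintegral => t; rewrite inE => Bt; rewrite fF.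
Qed.

Lemma wint_ge0 a f : (forall x, 0 <= f x) -> 0 <= wint a f.
Proof. by move=> f0; apply: Rintegral_ge0 => t _; rewrite mulr_ge0 ?powR_ge0. Qed.

Lemma wintD a f F : -1 < a -> ball_bcont f -> ball_bcont F ->
  wint a (f \+ F) = wint a f + wint a F.
Proof.
move=> a1 bf bF; rewrite /wint -RintegralD//.
- by apply: eq_Rintegral => t _; rewrite /= mulrDl.
- exact: integrable_weighted.
- exact: integrable_weighted.
Qed.

Lemma wintZ a c f : -1 < a -> ball_bcont f ->
  wint a (fun x => c * f x) = c * wint a f.
Proof.
move=> a1 bf; rewrite /wint -RintegralZl//.
  by apply: eq_Rintegral => t _; rewrite mulrA.
exact: integrable_weighted.
Qed.

Lemma wint_gap a F : wint (a + 1) F = wint a (fun x => gap x * F x).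
Proof.
apply: eq_Rintegral => t; rewrite inE => /ball_gap_gt0 t0.
by rewrite -mulr_powR// mulrCA mulrA.
Qed.

Lemma wint_ibp a f k : -1 < a -> ball_C1 f ->
  wint (a + 1) ('D_(delta_mx 0 k) f) =
  2 * (a + 1) * wint a (fun x => x 0 k * f x).
Proof.
move=> a1 [bf /(_ k)[df bDf]].
have bxf : ball_bcont (fun x : Rd => x 0 k * f x).
  by apply: ball_bcontM => //; exact: ball_bcont_coord.
pose b := a + 1.
have e0 n : 0 < n.+1%:R^-1 :> R by rewrite invr_gt0.
have ba : b - 1 = a by rewrite /b addrK.
pose F x := gap x `^ b * 'D_(delta_mx 0 k) f x - 2 * x 0 k * (b * gap x `^ a) * f x.
have F0 : (\int[mu]_(t in ballT) (F (row_of_tuple t))%:E = 0)%E.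
  have [_ [Cf hCf]] := bf; have [_ [CD hCD]] := bDf.
  apply: (@integral0_dominated a (fun n x => cutoff n.+1%:R^-1 b (gap x) *
      'D_(delta_mx 0 k) f x -
    2 * x 0 k * dcutoff n.+1%:R^-1 b (gap x) * f x) _
    (* The first summand uses [cutoff <= gap^b <= gap^a]; the second combines [|x_k| <= 1], the
       bound of [dcutoff] by [(2 + |b - 2|) gap^a], and the bound of [f]. *)
    (CD + 2 * (2 + `|b - 2|) * Cf)) => //.
  - move=> n; apply: (ball_bcontB (ball_bcontM _ bDf) (ball_bcontM
      (ball_bcontM (ball_bcontM (ball_bcont_cst 2) (ball_bcont_coord k)) _) bf)).1.
    + exact/(ball_bcont_comp_gap (p := cutoff _ b))/continuous_cutoff.
    + exact/(ball_bcont_comp_gap (p := dcutoff _ b))/continuous_dcutoff.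
  - apply: ball_contB (ball_contM _ bDf.1) (ball_contM (ball_contM _ (ball_contM
      (ball_bcont_cst b).1 (@ball_cont_powR_gap R d a))) bf.1).
      exact: ball_cont_powR_gap.
    exact: (ball_bcontM (ball_bcont_cst 2) (ball_bcont_coord k)).1.
  - move=> x /ball_gap_gt0 x0; apply: cvgB; apply: cvgMr_tmp.
      exact: cvg_cutoff.
    by apply: cvgMl_tmp; rewrite -ba; exact: cvg_dcutoff.
  - move=> n x Bx; have x0 := ball_gap_gt0 Bx.
    have /andP[c0 cb] := cutoff_itv b (e0 n) x0.
    have ga : gap x `^ b <= gap x `^ a.
      by apply: ger_powR; [rewrite x0 gap_le1|rewrite /b lerDl].
    rewrite [leRHS]mulrDl; apply: (le_trans (ler_normB _ _)); apply: lerD.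
      rewrite normrM mulrC ler_pM ?hCD// ger0_norm//; exact: le_trans ga.
    rewrite !normrM (ger0_norm (ler0n _ 2)).
    have := dcutoff_bound b (e0 n) x0; rewrite ba => dc.
    rewrite (_ : 2 * (2 + `|b - 2|) * Cf * gap x `^ a =
      2 * 1 * ((2 + `|b - 2|) * gap x `^ a) * Cf); last by ring.
    have ckx := coord_gap k x0.
    have xk0 : 0 <= 2 * `|x 0 k| by rewrite mulr_ge0.
    have xk1 : 2 * `|x 0 k| <= 2 * 1 by rewrite ler_pM2l.
    apply: (ler_pM (mulr_ge0 xk0 (normr_ge0 _)) (normr_ge0 _) _ (hCf _ Bx)).
    exact: (ler_pM xk0 (normr_ge0 _) xk1 dc).
  - by move=> n; apply: integral0_cutoff => //; [exact: bf.1|exact: bDf.1].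
apply/eqP; rewrite -subr_eq0 -wintZ// /wint -RintegralB//; last 2 first.
- by apply: (integrable_weighted (f := 'D_(delta_mx 0 k) f)) => //; lra.
- apply: (integrable_weighted (f := fun x => 2 * (a + 1) * (x 0 k * f x))) => //.
  exact: ball_bcontM (ball_bcont_cst _) bxf.
apply/eqP; transitivity (\int[mu]_(t in ballT) F (row_of_tuple t)).
  by apply: eq_Rintegral => t _; rewrite /F /b; ring.
by rewrite /Rintegral F0.
Qed.

(** The derivative of the cutoff contributes [x_i x_j dcutoff f] to both divergences, symmetrically
    in [i] and [j], so it cancels in their difference before [e] tends to 0. This matters because
    its bound [gap^(a-1)] may fail to be integrable; hence the exponent here is [a] and not
    [a + 1]. *)
Lemma wint_angular a f i j : -1 < a -> ball_C1 f ->
  wint a (fun x => x 0 i * 'D_(delta_mx 0 j) f x -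
                   x 0 j * 'D_(delta_mx 0 i) f x) = 0.
Proof.
move=> a1 f1; have [bf df] := f1.
have e0 n : 0 < n.+1%:R^-1 :> R by rewrite invr_gt0.
pose A (x : Rd) := x 0 i * 'D_(delta_mx 0 j) f x - x 0 j * 'D_(delta_mx 0 i) f x.
have bA : ball_bcont A.
  by apply: ball_bcontB; apply: ball_bcontM; [exact: ball_bcont_coord|
    exact: (df j).2|exact: ball_bcont_coord|exact: (df i).2].
pose c n (x : Rd) := cutoff n.+1%:R^-1 a (gap x) : R.
have bc n : ball_bcont (c n).
  exact/(ball_bcont_comp_gap (p := cutoff _ a))/continuous_cutoff.
pose G n l m (x : Rd) := c n x * 'D_(delta_mx 0 m) (fun y : Rd => y 0 l * f y) x -
  2 * x 0 m * dcutoff n.+1%:R^-1 a (gap x) * (x 0 l * f x).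
have xf1 l : ball_C1 (fun y : Rd => y 0 l * f y).
  by apply: ball_C1M => //; exact: ball_C1_coord.
have bG n l m : ball_bcont (G n l m).
  apply: ball_bcontB; first by apply: ball_bcontM => //; exact: ((xf1 l).2 m).2.
  apply: ball_bcontM; last exact: (xf1 l).1.
  apply: ball_bcontM; first exact: ball_bcontM (ball_bcont_cst 2) (ball_bcont_coord m).
  exact/(ball_bcont_comp_gap (p := dcutoff _ a))/continuous_dcutoff.
have G0 n l m : (\int[mu]_(t in ballT) (G n l m (row_of_tuple t))%:E = 0)%E.
  apply: (@integral0_cutoff _ _ (fun y : Rd => y 0 l * f y) m a n).
  - exact: (xf1 l).1.1.
  - exact: ((xf1 l).2 m).1.
  - exact: ((xf1 l).2 m).2.1.
have GA n (x : Rd) : unit_ball x -> G n i j x - G n j i x = c n x * A x.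
  move=> Bx.
  have dx l m : 'D_(delta_mx 0 m) (fun y : Rd => y 0 l * f y) x =
      x 0 l * 'D_(delta_mx 0 m) f x + f x * (l == m)%:R.
    have dl := is_derive_coord x m l.
    rewrite deriveM//; last exact: (df m).1.
    by rewrite derive_val.
  by rewrite /G /A !dx (eq_sym j i); ring.
have A0 : (\int[mu]_(t in ballT) (A (row_of_tuple t) * gap (row_of_tuple t) `^ a)%:E = 0)%E.
  have [cA [C hC]] := bA.
  apply: (@integral0_dominated a (fun n => c n \* A) (A \* (fun x => gap x `^ a)) C) => //.
  - by move=> n; exact: (ball_bcontM (bc n) bA).1.
  - by apply: ball_contM => //; exact: ball_cont_powR_gap.
  - move=> x /ball_gap_gt0 x0; rewrite /= mulrC; apply: cvgMr_tmp.
    exact: cvg_cutoff.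
  - move=> n x Bx; have /andP[c0 ca] := cutoff_itv a (e0 n) (ball_gap_gt0 Bx).
    by rewrite /= normrM mulrC ler_pM ?hC// ger0_norm.
  - move=> n; transitivity (\int[mu]_(t in ballT)
        ((G n i j (row_of_tuple t))%:E - (G n j i (row_of_tuple t))%:E))%E.
      by apply: eq_integral => t; rewrite inE => Bt; rewrite -EFinB GA.
    rewrite integralB_EFin//; [|exact: (integrable_ball_bcont (bG n i j))|
      exact: (integrable_ball_bcont (bG n j i))].
    by rewrite !G0 subee.
by rewrite /wint /Rintegral A0.
Qed.

End integration_by_parts.

Local Open Scope complex_scope.

(** * Complex-valued functions, through real and imaginary parts *)

Section complex_functions.
Context {R : realType} {d : nat}.
Local Notation Rd := 'rV[R]_d.
Local Notation Re := (@complex.Re R).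
Local Notation Im := (@complex.Im R).
Local Notation ballT := (row_of_tuple @^-1` (@unit_ball R d)).
Implicit Types (u v w : Rd -> R[i]) (x : Rd) (a : R) (i j k : 'I_d).

Lemma ReM (y z : R[i]) : Re (y * z) = Re y * Re z - Im y * Im z.
Proof. by case: y z => [? ?] [? ?]. Qed.

Lemma ImM (y z : R[i]) : Im (y * z) = Re y * Im z + Im y * Re z.
Proof. by case: y z => [? ?] [? ?]. Qed.

Lemma ReD (y z : R[i]) : Re (y + z) = Re y + Re z.
Proof. by case: y z => [? ?] [? ?]. Qed.

Lemma ImD (y z : R[i]) : Im (y + z) = Im y + Im z.
Proof. by case: y z => [? ?] [? ?]. Qed.

Lemma Re_conjc (z : R[i]) : Re (conjc z) = Re z.
Proof. by case: z. Qed.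

Lemma Im_conjc (z : R[i]) : Im (conjc z) = - Im z.
Proof. by case: z. Qed.

Lemma Re_RM (r : R) (z : R[i]) : Re (r%:C * z) = r * Re z.
Proof. by case: z => a b /=; rewrite mul0r subr0. Qed.

Lemma Im_RM (r : R) (z : R[i]) : Im (r%:C * z) = r * Im z.
Proof. by case: z => a b /=; rewrite mul0r addr0. Qed.

Lemma complex_ext (y z : R[i]) : Re y = Re z -> Im y = Im z -> y = z.
Proof. by case: y z => [? ?] [? ?] /= -> ->. Qed.

Lemma conjc_RM (r : R) (z : R[i]) : conjc (r%:C * z) = r%:C * conjc z.
Proof.
by apply: complex_ext; rewrite !(Re_conjc, Im_conjc, Re_RM, Im_RM) ?mulrN.
Qed.

(** Existence and value of the derivative in one relation, so that product and conjugation rules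
    compose without separate derivability goals. *)
Definition cderiv x k u (l : R[i]) :=
  is_derive x (delta_mx 0 k) (Re \o u) (Re l) /\
  is_derive x (delta_mx 0 k) (Im \o u) (Im l).

Lemma cderivE x k u l : cderiv x k u l -> partial k u x = l.
Proof. by move=> [[_ dr] [_ di]]; rewrite /partial dr di; case: l {dr di}. Qed.

Lemma pderivable_cderiv x k u : pderivable k u x -> cderiv x k u (partial k u x).
Proof. by move=> [dr di]; split; exact: DeriveDef. Qed.

Lemma cderivD x k u v l m : cderiv x k u l -> cderiv x k v m ->
  cderiv x k (fun y => u y + v y) (l + m).
Proof.
move=> [ur ui] [vr vi]; split.
  rewrite (_ : Re \o _ = (Re \o u) + (Re \o v)) ?ReD; last first.
    by apply/funext => y; rewrite /= ReD.
  exact: is_deriveD.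
rewrite (_ : Im \o _ = (Im \o u) + (Im \o v)) ?ImD; last first.
  by apply/funext => y; rewrite /= ImD.
exact: is_deriveD.
Qed.

Lemma cderivM x k u v l m : cderiv x k u l -> cderiv x k v m ->
  cderiv x k (fun y => u y * v y) (l * v x + u x * m).
Proof.
move=> [ur ui] [vr vi]; split.
  rewrite (_ : Re \o _ = (Re \o u) * (Re \o v) - (Im \o u) * (Im \o v)).
    apply: is_derive_eq; rewrite ReD !ReM /GRing.scale/=; ring.
  by apply/funext => y; rewrite /= ReM.
rewrite (_ : Im \o _ = (Re \o u) * (Im \o v) + (Im \o u) * (Re \o v)).
  apply: is_derive_eq; rewrite ImD !ImM /GRing.scale/=; ring.
by apply/funext => y; rewrite /= ImM.
Qed.

Lemma cderiv_conj x k u l : cderiv x k u l ->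
  cderiv x k (fun y => conjc (u y)) (conjc l).
Proof.
move=> [ur ui]; split.
  rewrite (_ : Re \o _ = Re \o u) ?Re_conjc//.
  by apply/funext => y; rewrite /= Re_conjc.
rewrite (_ : Im \o _ = - (Im \o u)) ?Im_conjc; first exact: is_deriveN.
by apply/funext => y; rewrite /= Im_conjc.
Qed.

Lemma cderiv_cst x k (c : R[i]) : cderiv x k (fun=> c) 0.
Proof. by split; exact: is_derive_cst. Qed.

Lemma cderiv_coord x k i : cderiv x k (fun y => (y 0 i)%:C) (i == k)%:R.
Proof.
split; first by rewrite (_ : Re _ = (i == k)%:R);
  [exact: is_derive_coord|case: (i == k)].
by rewrite (_ : Im _ = 0); [exact: is_derive_cst|case: (i == k)].
Qed.

Definition cball_bcont u := ball_bcont (Re \o u) /\ ball_bcont (Im \o u).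
Definition cball_C1 u := ball_C1 (Re \o u) /\ ball_C1 (Im \o u).

Lemma cball_C1_bcont u : cball_C1 u -> cball_bcont u.
Proof. by move=> [[? _] [? _]]. Qed.

Lemma cball_C1_cderiv u k x : cball_C1 u -> unit_ball x ->
  cderiv x k u (partial k u x).
Proof.
move=> [[_ /(_ k)[dr _]] [_ /(_ k)[di _]]] Bx; apply: pderivable_cderiv.
by split; [exact: dr|exact: di].
Qed.

Lemma cball_C1_partial u k : cball_C1 u -> cball_bcont (partial k u).
Proof. by move=> [[_ /(_ k)[_ br]] [_ /(_ k)[_ bi]]]. Qed.

Lemma eq_cball_bcont u v : (forall x, unit_ball x -> u x = v x) ->
  cball_bcont u -> cball_bcont v.
Proof.
move=> uv [br bi].
by split; [apply: eq_ball_bcont br|apply: eq_ball_bcont bi] => x Bx;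
  rewrite /= uv.
Qed.

Lemma cball_bcontD u v : cball_bcont u -> cball_bcont v ->
  cball_bcont (fun x => u x + v x).
Proof.
move=> [ur ui] [vr vi]; split.
  by apply: eq_ball_bcont (ball_bcontD ur vr) => x _; rewrite /= ReD.
by apply: eq_ball_bcont (ball_bcontD ui vi) => x _; rewrite /= ImD.
Qed.

Lemma cball_bcontM u v : cball_bcont u -> cball_bcont v ->
  cball_bcont (fun x => u x * v x).
Proof.
move=> [ur ui] [vr vi]; split.
  apply: eq_ball_bcont (ball_bcontB (ball_bcontM ur vr) (ball_bcontM ui vi)).
  by move=> x _; rewrite /= ReM.
apply: eq_ball_bcont (ball_bcontD (ball_bcontM ur vi) (ball_bcontM ui vr)).
by move=> x _; rewrite /= ImM.
Qed.

Lemma cball_bcont_conj u : cball_bcont u -> cball_bcont (fun x => conjc (u x)).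
Proof.
move=> [ur ui]; split.
  by apply: eq_ball_bcont ur => x _; rewrite /= Re_conjc.
by apply: eq_ball_bcont (ball_bcontN ui) => x _; rewrite /= Im_conjc.
Qed.

Lemma cball_bcont_cst (c : R[i]) : cball_bcont (fun=> c).
Proof. by split; exact: ball_bcont_cst. Qed.

Lemma cball_bcont_coord i : cball_bcont (fun x => (x 0 i)%:C).
Proof. by split; [exact: ball_bcont_coord|exact: ball_bcont_cst]. Qed.

Lemma cball_C1M u v : cball_C1 u -> cball_C1 v -> cball_C1 (fun x => u x * v x).
Proof.
move=> [ur ui] [vr vi]; split.
  rewrite (_ : _ \o _ = ((Re \o u) \* (Re \o v)) \+
    (cst (-1) \* ((Im \o u) \* (Im \o v)))); last first.
    by apply/funext => y; rewrite /= ReM mulN1r.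
  apply: ball_C1D; first exact: ball_C1M.
  by apply: ball_C1M (ball_C1_cst _) _; exact: ball_C1M.
rewrite (_ : _ \o _ = ((Re \o u) \* (Im \o v)) \+ ((Im \o u) \* (Re \o v))).
  by apply: ball_C1D; exact: ball_C1M.
by apply/funext => y; rewrite /= ImM.
Qed.

Lemma cball_C1D u v : cball_C1 u -> cball_C1 v -> cball_C1 (fun x => u x + v x).
Proof.
move=> [ur ui] [vr vi]; split.
  rewrite (_ : _ \o _ = (Re \o u) \+ (Re \o v)); first exact: ball_C1D.
  by apply/funext => y; rewrite /= ReD.
rewrite (_ : _ \o _ = (Im \o u) \+ (Im \o v)); first exact: ball_C1D.
by apply/funext => y; rewrite /= ImD.
Qed.

Lemma cball_C1_conj u : cball_C1 u -> cball_C1 (fun x => conjc (u x)).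
Proof.
move=> [ur ui]; split.
  by rewrite (_ : _ \o _ = Re \o u)//; apply/funext => y; rewrite /= Re_conjc.
rewrite (_ : _ \o _ = cst (-1) \* (Im \o u)).
  exact: ball_C1M (ball_C1_cst _) _.
by apply/funext => y; rewrite /= Im_conjc mulN1r.
Qed.

Lemma cball_C1_cst (c : R[i]) : cball_C1 (fun=> c).
Proof. by split; exact: ball_C1_cst. Qed.

Lemma cball_C1_coord i : cball_C1 (fun x => (x 0 i)%:C).
Proof. by split; [exact: ball_C1_coord|exact: ball_C1_cst]. Qed.

Definition cwint a u : R[i] := wint a (Re \o u) +i* wint a (Im \o u).

Lemma ipE a u v : ip a u v = cwint a (fun x => u x * conjc (v x)).
Proof.
rewrite /ip /Cintegral /cwint /wint.
by congr (_ +i* _); apply: eq_Rintegral => t _;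
  rewrite /= gapE mulrC ?Re_RM ?Im_RM mulrC.
Qed.

Lemma Re_cwint a u : Re (cwint a u) = wint a (Re \o u).
Proof. by []. Qed.

Lemma Im_cwint a u : Im (cwint a u) = wint a (Im \o u).
Proof. by []. Qed.

Lemma eq_cwint a u v : (forall x, unit_ball x -> u x = v x) ->
  cwint a u = cwint a v.
Proof.
by move=> uv; congr (_ +i* _); apply: eq_wint => x Bx; rewrite /= uv.
Qed.

Lemma cwintD a u v : -1 < a -> cball_bcont u -> cball_bcont v ->
  cwint a (fun x => u x + v x) = cwint a u + cwint a v.
Proof.
move=> a1 [ur ui] [vr vi]; apply: complex_ext; rewrite /= -wintD//.
  by apply: eq_wint => x _; rewrite /= ReD.
by apply: eq_wint => x _; rewrite /= ImD.
Qed.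

Lemma cwintZ a (c : R[i]) u : -1 < a -> cball_bcont u ->
  cwint a (fun x => c * u x) = c * cwint a u.
Proof.
move=> a1 [ur ui]; apply: complex_ext; rewrite /= ?ReM ?ImM /=.
  rewrite -mulNr -!wintZ// -wintD//; try exact: ball_bcontM (ball_bcont_cst _) _.
  by apply: eq_wint => x _; rewrite /= ReM mulNr.
rewrite -!wintZ// -wintD//; try exact: ball_bcontM (ball_bcont_cst _) _.
by apply: eq_wint => x _; rewrite /= ImM.
Qed.

Lemma cwint_gap a u : cwint (a + 1) u = cwint a (fun x => (gap x)%:C * u x).
Proof.
apply: complex_ext; rewrite /= wint_gap; apply: eq_wint => x _ /=.
  by rewrite Re_RM.
by rewrite Im_RM.
Qed.

Lemma cwint_conj a u : -1 < a -> cball_bcont u ->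
  cwint a (fun x => conjc (u x)) = conjc (cwint a u).
Proof.
move=> a1 [_ ui]; apply: complex_ext; rewrite /= ?Re_conjc ?Im_conjc.
  by apply: eq_wint => x _; rewrite /= Re_conjc.
by rewrite /= -mulN1r -wintZ//; apply: eq_wint => x _; rewrite /= Im_conjc mulN1r.
Qed.

Lemma ipC a u v : -1 < a -> cball_bcont u -> cball_bcont v ->
  ip a v u = conjc (ip a u v).
Proof.
move=> a1 bu bv; rewrite !ipE -cwint_conj//.
  by apply: eq_cwint => x _; rewrite rmorphM/= conjcK mulrC.
by apply: cball_bcontM => //; exact: cball_bcont_conj.
Qed.

Lemma cwint_ibp a u k : -1 < a -> cball_C1 u ->
  cwint (a + 1) (partial k u) =
  (2 * (a + 1))%:C * cwint a (fun x => (x 0 k)%:C * u x).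
Proof.
move=> a1 [ur ui]; apply: complex_ext; rewrite ?Re_RM ?Im_RM /=.
  rewrite -[LHS]/(wint (a + 1) ('D_(delta_mx 0 k) (Re \o u))) wint_ibp//.
  by congr (_ * _); apply: eq_wint => x _; rewrite /= Re_RM.
rewrite -[LHS]/(wint (a + 1) ('D_(delta_mx 0 k) (Im \o u))) wint_ibp//.
by congr (_ * _); apply: eq_wint => x _; rewrite /= Im_RM.
Qed.

Lemma cwint_angular a u i j : -1 < a -> cball_C1 u ->
  cwint a (angular i j u) = 0.
Proof.
move=> a1 [ur ui].
have Rsub (y z : R[i]) : Re (y - z) = Re y - Re z by case: y z => [? ?] [? ?].
have Isub (y z : R[i]) : Im (y - z) = Im y - Im z by case: y z => [? ?] [? ?].
apply: complex_ext => /=.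
  rewrite -[RHS](wint_angular i j a1 ur); apply: eq_wint => x _.
  by rewrite -[LHS]/(Re (angular i j u x)) /angular Rsub !Re_RM.
rewrite -[RHS](wint_angular i j a1 ui); apply: eq_wint => x _.
by rewrite -[LHS]/(Im (angular i j u x)) /angular Isub !Im_RM.
Qed.

End complex_functions.

(** * Euler, Laplace and rotation operators on polynomials *)

Section ball_operators.
Context {d : nat} {A : comNzRingType}.
Local Notation poly := (mpoly d A).
Local Notation "'X_ k" := (mpolyX A (mnm1 k)) (at level 8, k at level 2, format "''X_' k").
Implicit Types (p q C : poly) (i j k : 'I_d).

(** Swapping indices sends the terms [G j i] to the pairs below the diagonal. The unrestricted
    double sum is the form in which [euler] and [laplace] can be recognised. *)
Lemma sum_ltn_sym (V : zmodType) (G : 'I_d -> 'I_d -> V) :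
  (forall i, G i i = 0) ->
  \sum_(i < d) \sum_(j < d | (i < j)%N) (G i j + G j i) =
  \sum_(i < d) \sum_(j < d) G i j.
Proof.
move=> G0.
under eq_bigr do rewrite big_split /=.
rewrite big_split /= [X in _ + X](exchange_big_dep xpredT)//= -big_split /=.
apply: eq_bigr => i _.
rewrite [RHS](bigID (fun j : 'I_d => (i < j)%N))/=; congr (_ + _).
rewrite [RHS](bigD1 i) ?ltnn//= G0 add0r; apply: eq_bigl => j.
by rewrite -leqNgt ltn_neqAle andbC.
Qed.

Definition euler p : poly := \sum_(k < d) 'X_k * mderiv k p.
Definition laplace p : poly := \sum_(k < d) mderiv k (mderiv k p).

Lemma eulerD p q : euler (p + q) = euler p + euler q.
Proof.
by rewrite /euler -big_split; apply: eq_bigr => k _; rewrite mderivD mulrDr.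
Qed.

Lemma mderiv_sum (I : Type) (s : seq I) (P : pred I) (F : I -> poly) k :
  mderiv k (\sum_(l <- s | P l) F l) = \sum_(l <- s | P l) mderiv k (F l).
Proof. exact: (big_morph _ (mderivD k) (mderiv0 _ k)). Qed.

Lemma mderivXU i k : mderiv k 'X_i = (i == k)%:R :> poly.
Proof.
rewrite mderivX mnm1E; case: eqVneq => [->|_]; last by rewrite scale0r.
rewrite scale1r (_ : mnm_sub _ _ = mnm0) ?mpolyX0//.
by apply/mnmP => l; rewrite mnmBE mnm0E subnn.
Qed.

Lemma mderivXM i k p :
  mderiv k ('X_i * p) = (i == k)%:R * p + 'X_i * mderiv k p.
Proof. by rewrite mderivM mderivXU. Qed.

Lemma mderiv_euler k p : mderiv k (euler p) = euler (mderiv k p) + mderiv k p.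
Proof.
rewrite /euler mderiv_sum addrC.
under eq_bigr do rewrite mderivXM mderiv_comm.
rewrite big_split /= (bigD1 k)//= eqxx mul1r big1 ?addr0// => i /negPf ->.
by rewrite mul0r.
Qed.

Lemma mderiv_laplace k p : mderiv k (laplace p) = laplace (mderiv k p).
Proof.
rewrite /laplace mderiv_sum; apply: eq_bigr => i _.
by rewrite (mderiv_comm i k (mderiv i p)) (mderiv_comm i k).
Qed.

Definition ball_op C p : poly := euler (euler p) + C * euler p - laplace p.

Definition sobolev_op C p : poly :=
  euler (euler p) + (C - 2) * euler p + (1 - C) * p - laplace p.

(* [sobolev_op C] is [(E - 1) (E - 1 + C) - laplace], [ball_op C] is
   [E (E + C) - laplace], and [d_k E = (E + 1) d_k]. *)
Lemma mderiv_sobolev_op k C p : mderiv k C = 0 ->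
  mderiv k (sobolev_op C p) = ball_op C (mderiv k p).
Proof.
move=> C0; have two0 : mderiv k (2 : poly) = 0 by rewrite -mpolyC_nat mderivC.
have one0 : mderiv k (1 : poly) = 0 by rewrite -mpolyC1 mderivC.
rewrite /sobolev_op /ball_op mderivB mderivD mderivD !mderivM !mderivB C0.
rewrite two0 one0 mderiv_laplace !mderiv_euler eulerD; ring.
Qed.

Definition rot_poly i j p : poly := 'X_i * mderiv j p - 'X_j * mderiv i p.

Definition sqnorm_poly : poly := \sum_(i < d) 'X_i ^+ 2.

(** The left side is the angular part of the Laplacian, and the identity is its classical form
    [|x|^2 Delta - E (E + d - 2)]. *)
Lemma sum_rot_poly p :
  \sum_(i < d) \sum_(j < d | (i < j)%N) rot_poly i j (rot_poly i j p) =
  sqnorm_poly * laplace p - euler (euler p) + (2 - d%:R) * euler p.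
Proof.
(* Half of the expanded square [D_{i,j}^2]; the other half is [G j i], and the diagonal vanishes. *)
pose G i j := 'X_i * mderiv j ('X_i * mderiv j p) -
              'X_i * mderiv j ('X_j * mderiv i p).
transitivity (\sum_(i < d) \sum_(j < d | (i < j)%N) (G i j + G j i)).
  apply: eq_bigr => i _; apply: eq_bigr => j _.
  by rewrite /rot_poly /G !mderivB; ring.
rewrite sum_ltn_sym => [|i]; last by rewrite /G subrr.
have GE i j : G i j = 'X_i * ((i == j)%:R * mderiv j p) +
    'X_i ^+ 2 * mderiv j (mderiv j p) -
    ('X_i * mderiv i p + 'X_i * ('X_j * mderiv j (mderiv i p))).
  by rewrite /G !mderivXM eqxx mulr1n; ring.
have -> : \sum_(i < d) \sum_(j < d) G i j = \sum_(i < d) ('X_i * mderiv i p +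
    'X_i ^+ 2 * laplace p - ('X_i * mderiv i p *+ d + 'X_i * euler (mderiv i p))).
  apply: eq_bigr => i _; under eq_bigr do rewrite GE.
  rewrite sumrB !big_split /= -!mulr_sumr sumr_const card_ord.
  rewrite -/(laplace p) -/(euler _) mulrnAr; congr ('X_i * _ + _ - _).
  rewrite (bigD1 i)//= eqxx mul1r big1 ?addr0// => j /negPf.
  by rewrite eq_sym => ->; rewrite mul0r.
rewrite sumrB !big_split /= -mulr_suml -/(euler p) -/sqnorm_poly.
rewrite sumrMnl -/(euler p).
(* From [d_i E = (E + 1) d_i]. *)
have -> : \sum_(i < d) 'X_i * euler (mderiv i p) = euler (euler p) - euler p.
  rewrite /(euler (euler p)) /euler -sumrB; apply: eq_bigr => i _.
  by rewrite -/(euler p) mderiv_euler -/(euler _); ring.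
by rewrite -mulr_natl; ring.
Qed.

Lemma eulerZ c p : euler (c *: p) = c *: euler p.
Proof.
by rewrite /euler scaler_sumr; apply: eq_bigr => k _; rewrite mderivZ scalerAr.
Qed.

Lemma eulerX (m : multinom d) : euler (mpolyX A m) = (mdeg m)%:R *: mpolyX A m.
Proof.
rewrite mdegE natr_sum scaler_suml /euler; apply: eq_bigr => k _.
rewrite mderivX -scalerAr; have [->|mk] := eqVneq (m k) 0%N.
  by rewrite !scale0r.
by rewrite mulrC -mpolyXD submK// lep1mP.
Qed.

Lemma mpoly_linearE (f : poly -> poly) p :
  {morph f : q r / q + r} -> (forall c, {morph f : q / c *: q}) ->
  f p = \sum_(m <- msupp p) mcoeff m p *: f (mpolyX A m).
Proof.
move=> fD fZ; have f0 : f 0 = 0 by rewrite -(scale0r 0) fZ !scale0r.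
by rewrite {1}(mpolyE p) (big_morph f fD f0); apply: eq_bigr => m _; rewrite fZ.
Qed.

Lemma msize_sum_le (I : eqType) (s : seq I) (F : I -> poly) n :
  (forall l, l \in s -> (msize (F l) <= n)%N) ->
  (msize (\sum_(l <- s) F l) <= n)%N.
Proof.
move=> Fn; rewrite (leq_trans (msize_sum _ _ _))//.
by rewrite big_seq; apply/bigmax_leqP_seq => l _ /Fn.
Qed.

(** Checked on monomials. If [X_k] is absent, the truncated subtraction of exponents does not lower
    the degree, but the coefficient [m k] is then 0. *)
Lemma msize_mderiv k p n : (msize p <= n.+1)%N -> (msize (mderiv k p) <= n)%N.
Proof.
move=> pn; rewrite (mpoly_linearE p (mderivD k) (fun c q => mderivZ k c q)).
apply: msize_sum_le => m /msize_mdeg_lt mp.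
rewrite mderivX (leq_trans (msizeZ_le _ _))//.
have [->|mk] := eqVneq (m k) 0%N; first by rewrite scale0r mmeasure0.
rewrite (leq_trans (msizeZ_le _ _))// msizeX.
have : (mdeg (mnm_add (mnm_sub m (mnm1 k)) (mnm1 k)) < n.+1)%N.
  by rewrite submK ?lep1mP//; exact: leq_trans pn.
by rewrite mdegD mdeg1 addn1.
Qed.

Lemma msize_laplace p n : (msize p <= n.+1)%N -> (msize (laplace p) <= n)%N.
Proof.
move=> pn; apply: msize_sum_le => k _; apply: msize_mderiv.
exact: leq_trans (msize_mderiv k pn) (leqnSn n).
Qed.

Lemma msize_euler p n : (msize p <= n)%N -> (msize (euler p) <= n)%N.
Proof.
move=> pn; rewrite (mpoly_linearE p eulerD eulerZ).
apply: msize_sum_le => m /msize_mdeg_lt mp; rewrite eulerX.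
do 2 rewrite (leq_trans (msizeZ_le _ _))//.
by rewrite msizeX; exact: leq_trans pn.
Qed.

(** Monomials are eigenvectors of [euler] with their degree as eigenvalue, so [E - n] kills the part
    of degree exactly [n]. *)
Lemma msize_euler_top p n : (msize p <= n.+1)%N ->
  (msize (euler p - n%:R * p) <= n)%N.
Proof.
move=> pn; have -> : euler p - n%:R * p =
    \sum_(m <- msupp p) (mcoeff m p * ((mdeg m)%:R - n%:R)) *: mpolyX A m.
  rewrite (mpoly_linearE p eulerD eulerZ) {3}(mpolyE p) mulr_sumr -sumrB.
  apply: eq_bigr => m _; rewrite eulerX -mpolyC_nat mul_mpolyC scalerA.
  by rewrite scalerA -scalerBl (mulrC n%:R) -mulrBr.
apply: msize_sum_le => m /msize_mdeg_lt mp.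
have [->|mn] := eqVneq (mdeg m) n; first by rewrite subrr mulr0 scale0r mmeasure0.
rewrite (leq_trans (msizeZ_le _ _))// msizeX ltn_neqAle mn.
by rewrite -ltnS; exact: leq_trans pn.
Qed.

Lemma msizeD_le p q n : (msize p <= n)%N -> (msize q <= n)%N ->
  (msize (p + q) <= n)%N.
Proof.
by move=> pn qn; rewrite (leq_trans (mmeasureD_le _ _ _))// geq_max pn.
Qed.

Lemma msizeCM_le (c : A) p n : (msize p <= n)%N -> (msize (mpolyC d c * p) <= n)%N.
Proof. by move=> pn; rewrite mul_mpolyC (leq_trans (msizeZ_le _ _)). Qed.

Lemma msize_sobolev_op (c : A) p n : (msize p <= n)%N ->
  (msize (sobolev_op (mpolyC d c) p) <= n)%N.
Proof.
move=> pn; rewrite /sobolev_op -mpolyC_nat -mpolyC1 -!mpolyCB.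
apply: msizeD_le; last by rewrite msizeN msize_laplace// ltnW.
by rewrite !msizeD_le ?msizeCM_le ?msize_euler.
Qed.

Definition top_eigenvalue (c : A) n : A := (n%:R - 1) * (n%:R - 1 + c).

(** As a polynomial in [E], [(E - 1)(E - 1 + c)] minus its value at [n] equals
    [(E + n + c - 2)(E - n)]. The factor [E - n] removes the leading part, and the Laplacian lowers
    the degree anyway. *)
Lemma msize_sobolev_op_top (c : A) p n : (msize p <= n.+1)%N ->
  (msize (sobolev_op (mpolyC d c) p -
    mpolyC d (top_eigenvalue c n) * p) <= n)%N.
Proof.
move=> pn; rewrite /top_eigenvalue; set F := euler p - n%:R * p.
have -> : sobolev_op (mpolyC d c) p -
    mpolyC d ((n%:R - 1) * (n%:R - 1 + c)) * p =
    euler F + mpolyC d (n%:R + c - 2) * F - laplace p.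
  have -> : euler F = euler (euler p) - n%:R * euler p.
    have nE q : n%:R * q = n%:R *: q by rewrite -mpolyC_nat mul_mpolyC.
    by rewrite /F !nE -!scaleNr eulerD eulerZ.
  rewrite /sobolev_op /F mpolyCM !(mpolyCD, mpolyCN) mpolyC1 !mpolyC_nat; ring.
have Fn : (msize F <= n)%N by exact: msize_euler_top.
apply: msizeD_le; last by rewrite msizeN msize_laplace.
by rewrite msizeD_le ?msizeCM_le ?msize_euler.
Qed.

End ball_operators.

Lemma rmorph_top_eigenvalue (A B : comNzRingType) (f : {rmorphism A -> B}) c n :
  f (top_eigenvalue c n) = top_eigenvalue (f c) n.
Proof. by rewrite /top_eigenvalue !(rmorphM, rmorphD, rmorphN, rmorph1, rmorph_nat). Qed.

(** * Bounds from continuous extension to the closed ball *)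

Section closed_ball_extension.
Context {R : realType} {d : nat}.
Local Notation Rd := 'rV[R]_d.
Local Notation Re := (@complex.Re R).
Local Notation Im := (@complex.Im R).
Implicit Types (u v : Rd -> R[i]) (x : Rd) (a : R) (i j k : 'I_d).

Lemma compact_closure_unit_ball : compact (closure (@unit_ball R d)).
Proof.
have cbox : compact [set x : Rd | forall i, `[-1, 1]%classic (x 0 i)].
  by apply: (@rV_compact R d (fun=> `[-1, 1]%classic)) => _; exact: segment_compact.
apply: (subclosed_compact (@closed_closure _ _) cbox).
have clbox : closed [set x : Rd | forall i, `[-1, 1]%classic (x 0 i)].
  by apply: (compact_closed _ cbox); exact: norm_hausdorff.
rewrite (iffLR (closure_id _) clbox); apply: closureS => x.
rewrite unit_ballE => /= x0 i.
by rewrite in_itv/= -ler_norml; exact: coord_gap.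
Qed.

(** Continuity on the compact closed ball supplies the bounds that dominated convergence requires;
    this is how regularity up to the boundary enters. *)
Lemma ball_bcont_within (f : Rd -> R) :
  {within closure unit_ball, continuous f} -> ball_bcont f.
Proof.
move=> cf; split.
  rewrite /ball_cont -(continuous_open_subspace f (@open_unit_ball R d)).
  by apply: continuous_subspaceW cf; exact: subset_closure.
have /compact_bounded[M [_ hM]] :=
  continuous_compact cf compact_closure_unit_ball.
exists (`|M| + 1) => x Bx.
apply: (hM (`|M| + 1)); first by rewrite ltr_pwDr// ler_norm.
by exists x => //; exact: subset_closure.
Qed.

Lemma extends_continuously_bcont u : extends_continuously u -> cball_bcont u.
Proof.
move=> [v [cr ci vu]]; apply: (eq_cball_bcont vu).
by split; exact: ball_bcont_within.
Qed.

Lemma Cbar_extends m u : Cbar m u -> extends_continuously u.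
Proof. by case: m => [|m] []. Qed.

Lemma CbarS_C1 m u : Cbar m.+1 u -> cball_C1 u.
Proof.
move=> [/extends_continuously_bcont[ur ui] du].
split; split => // k; have [pd /Cbar_extends/extends_continuously_bcont[br bi]] := du k.
  by split => // x /pd[].
by split => // x /pd[].
Qed.

End closed_ball_extension.

(** * Polynomial functions and adjoints of the derivations *)

Section polynomial_functions.
Context {R : realType} {d : nat}.
Local Notation Rd := 'rV[R]_d.
Local Notation poly := (mpoly d R[i]).
Local Notation "'X_ k" := (mpolyX R[i] (mnm1 k)) (at level 8, k at level 2, format "''X_' k").
Implicit Types (p q : poly) (x : Rd) (a : R) (i j k : 'I_d).

(** Induction over ring generators: facts about [poly_fun] then follow from the closure rules for
    constants, coordinates, sums and products. *)
Lemma mpoly_ring_ind (P : poly -> Prop) :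
  (forall c, P (mpolyC d c)) -> (forall k, P 'X_k) ->
  (forall p q, P p -> P q -> P (p + q)) ->
  (forall p q, P p -> P q -> P (p * q)) -> forall p, P p.
Proof.
move=> PC PX PD PM p; rewrite (mpolyE p).
apply: (big_ind P); [by rewrite -mpolyC0|exact: PD|move=> m _].
rewrite -mul_mpolyC mpolyXE_id; apply: (PM) => //.
apply: (big_ind P); [by rewrite -mpolyC1|exact: PM|move=> i _].
by elim: (m i) => [|n IHn]; rewrite ?expr0 -?mpolyC1// exprS; exact: (PM).
Qed.

Lemma poly_funD p q : poly_fun (p + q) = fun x => poly_fun p x + poly_fun q x.
Proof. by apply/funext => x; rewrite /poly_fun mevalD. Qed.

Lemma poly_funM p q : poly_fun (p * q) = fun x => poly_fun p x * poly_fun q x.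
Proof. by apply/funext => x; rewrite /poly_fun mevalM. Qed.

Lemma poly_funC c : poly_fun (mpolyC d c) = fun=> c :> R[i].
Proof. by apply/funext => x; rewrite /poly_fun mevalC. Qed.

Lemma poly_funX k : poly_fun 'X_k = fun x => (x 0 k)%:C.
Proof. by apply/funext => x; rewrite /poly_fun mevalXU. Qed.

Lemma poly_funZ c p : poly_fun (c *: p) = fun x => c * poly_fun p x.
Proof. by apply/funext => x; rewrite /poly_fun mevalZ. Qed.

Lemma cderiv_poly p x k : cderiv x k (poly_fun p) (poly_fun (mderiv k p) x).
Proof.
elim/mpoly_ring_ind: p => [c|i|p q dp dq|p q dp dq].
- by rewrite mderivC poly_funC /poly_fun meval0; exact: cderiv_cst.
- rewrite mderivXU -mpolyC_nat.
  by rewrite poly_funX poly_funC; exact: cderiv_coord.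
- by rewrite mderivD !poly_funD; exact: cderivD.
- by rewrite mderivM !poly_funD !poly_funM; exact: cderivM.
Qed.

Lemma partial_poly p k : partial k (poly_fun p) = poly_fun (mderiv k p).
Proof. by apply/funext => x; exact/cderivE/cderiv_poly. Qed.

Lemma cball_C1_poly p : cball_C1 (@poly_fun R d p).
Proof.
elim/mpoly_ring_ind: p => [c|i|p q dp dq|p q dp dq].
- by rewrite poly_funC; exact: cball_C1_cst.
- by rewrite poly_funX; exact: cball_C1_coord.
- by rewrite poly_funD; exact: cball_C1D.
- by rewrite poly_funM; exact: cball_C1M.
Qed.

Lemma cball_bcont_poly p : cball_bcont (@poly_fun R d p).
Proof. exact/cball_C1_bcont/cball_C1_poly. Qed.

Lemma ip_polyD a p q (v : Rd -> R[i]) : -1 < a -> cball_bcont v ->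
  ip a (poly_fun (p + q)) v = ip a (poly_fun p) v + ip a (poly_fun q) v.
Proof.
move=> a1 bv; rewrite !ipE -cwintD//.
- by apply: eq_cwint => x _; rewrite poly_funD mulrDl.
- by apply: cball_bcontM; [exact: cball_bcont_poly|exact: cball_bcont_conj].
- by apply: cball_bcontM; [exact: cball_bcont_poly|exact: cball_bcont_conj].
Qed.

Lemma ip_polyZ a c p (v : Rd -> R[i]) : -1 < a -> cball_bcont v ->
  ip a (poly_fun (c *: p)) v = c * ip a (poly_fun p) v.
Proof.
move=> a1 bv; rewrite !ipE -cwintZ//.
  by apply: eq_cwint => x _; rewrite poly_funZ mulrA.
by apply: cball_bcontM; [exact: cball_bcont_poly|exact: cball_bcont_conj].
Qed.

Lemma ip_poly0 a (v : Rd -> R[i]) : -1 < a -> cball_bcont v ->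
  ip a (poly_fun 0) v = 0.
Proof. by move=> a1 bv; rewrite -(scale0r 0) ip_polyZ// mul0r. Qed.

Lemma ip_polyN a p (v : Rd -> R[i]) : -1 < a -> cball_bcont v ->
  ip a (poly_fun (- p)) v = - ip a (poly_fun p) v.
Proof. by move=> a1 bv; rewrite -scaleN1r ip_polyZ// mulN1r. Qed.

Lemma ip_poly_sum a (I : Type) (s : seq I) (P : pred I) (F : I -> poly)
    (v : Rd -> R[i]) : -1 < a -> cball_bcont v ->
  ip a (poly_fun (\sum_(l <- s | P l) F l)) v =
  \sum_(l <- s | P l) ip a (poly_fun (F l)) v.
Proof.
move=> a1 bv.
apply: (big_morph (fun p => ip a (poly_fun p) v)); last exact: ip_poly0.
by move=> p q; exact: ip_polyD.
Qed.

Definition gap_poly : poly := 1 - sqnorm_poly.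

Lemma poly_fun_gap x : poly_fun gap_poly x = (gap x)%:C.
Proof.
rewrite /poly_fun /gap_poly mevalB meval1 /gap [RHS]rmorphB [X in X - _]rmorph1.
congr (_ - _).
rewrite (big_morph _ (mevalD _) (meval0 _)) [RHS]rmorph_sum.
by apply: eq_bigr => i _; rewrite expr2 mevalM !mevalXU -rmorphM.
Qed.

Lemma angular_poly i j p :
  angular i j (poly_fun p) = poly_fun (rot_poly i j p).
Proof.
apply/funext => x; rewrite /angular !partial_poly /rot_poly /poly_fun.
by rewrite mevalB !mevalM !mevalXU.
Qed.

(** Integration by parts for [p] times the conjugate of [v]. The right side is the formal adjoint
    [2 (a + 1) x_k - (1 - |x|^2) d_k], with the weight lowered from [a + 1] to [a] so that it can be
    added to the angular terms. *)
Lemma ip_poly_partial a p k (v : Rd -> R[i]) : -1 < a -> cball_C1 v ->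
  ip (a + 1) (poly_fun p) (partial k v) =
  ip a (poly_fun ((2 * (a + 1))%:C *: ('X_k * p) - gap_poly * mderiv k p)) v.
Proof.
move=> a1 v1.
have bcv := cball_bcont_conj (cball_C1_bcont v1).
have a2 : -1 < a + 1 by lra.
have bv := cball_C1_bcont v1.
have := cwint_ibp k a1 (cball_C1M (cball_C1_poly p) (cball_C1_conj v1)).
rewrite (@eq_cwint _ _ _ _ (fun x => poly_fun (mderiv k p) x * conjc (v x) +
    poly_fun p x * conjc (partial k v x))); last first.
  move=> x Bx; apply: cderivE; apply: cderivM; first exact: cderiv_poly.
  by apply: cderiv_conj; exact: cball_C1_cderiv.
rewrite cwintD//; last 2 first.
- exact: (cball_bcontM (cball_bcont_poly _) bcv).
- apply: (cball_bcontM (cball_bcont_poly _)).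
  by apply: cball_bcont_conj; exact: cball_C1_partial.
rewrite cwint_gap => h.
rewrite ip_polyD// ip_polyN// ip_polyZ// !ipE.
rewrite (@eq_cwint _ _ _ (fun x => poly_fun ('X_k * p) x * _)
    (fun x => (x 0 k)%:C * (poly_fun p x * conjc (v x)))); last first.
  by move=> x _; rewrite poly_funM poly_funX mulrA.
rewrite -h (@eq_cwint _ _ _ (fun x => poly_fun (gap_poly * _) x * _)
    (fun x => (gap x)%:C * (poly_fun (mderiv k p) x * conjc (v x)))).
  by rewrite addrAC subrr add0r.
by move=> x _; rewrite poly_funM poly_fun_gap mulrA.
Qed.

(** Rotations preserve the weighted measure, so their generators [D_{i,j}] are skew-adjoint. *)
Lemma ip_poly_angular a p i j (v : Rd -> R[i]) : -1 < a -> cball_C1 v ->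
  ip a (poly_fun p) (angular i j v) = - ip a (poly_fun (rot_poly i j p)) v.
Proof.
move=> a1 v1.
have bv := cball_C1_bcont v1.
have bcv := cball_bcont_conj bv.
have bav : cball_bcont (angular i j v).
  rewrite (_ : angular i j v = fun x => (x 0 i)%:C * partial j v x +
    -1 * ((x 0 j)%:C * partial i v x)); last first.
    by apply/funext => x; rewrite mulN1r.
  apply: cball_bcontD.
    by apply: cball_bcontM (cball_bcont_coord i) _; exact: cball_C1_partial.
  apply: cball_bcontM (cball_bcont_cst _) _.
  by apply: cball_bcontM (cball_bcont_coord j) _; exact: cball_C1_partial.
apply/eqP; rewrite -addr_eq0 !ipE -cwintD//; last 2 first.
- by apply: (cball_bcontM (cball_bcont_poly _)); exact: cball_bcont_conj.
- exact: (cball_bcontM (cball_bcont_poly _) bcv).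
apply/eqP.
rewrite -[RHS](cwint_angular i j a1 (cball_C1M (cball_C1_poly p) (cball_C1_conj v1))).
apply: eq_cwint => x Bx.
have dx l : partial l (fun y => poly_fun p y * conjc (v y)) x =
    poly_fun (mderiv l p) x * conjc (v x) + poly_fun p x * conjc (partial l v x).
  apply: cderivE; apply: cderivM; first exact: cderiv_poly.
  by apply: cderiv_conj; exact: cball_C1_cderiv.
have conjB (y z : R[i]) : conjc (y - z) = conjc y - conjc z by exact: rmorphB.
rewrite /angular !dx conjB !conjc_RM.
rewrite /rot_poly /poly_fun mevalB !mevalM !mevalXU -!/(poly_fun _ _).
ring.
Qed.

End polynomial_functions.

(* Otherwise unification unfolds the integrals. *)
#[local] Opaque ip cwint wint.

(** * Symmetry of the operator and the eigenvalue identity *)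

Section spectral_identity.
Context {R : realType} {d : nat}.
Local Notation Rd := 'rV[R]_d.
Local Notation poly := (mpoly d R[i]).
Local Notation Re := (@complex.Re R).
Local Notation Im := (@complex.Im R).
Local Notation "'X_ k" := (mpolyX R[i] (mnm1 k)) (at level 8, k at level 2, format "''X_' k").
Implicit Types (p q : poly) (u v : Rd -> R[i]) (a : R) (i j k : 'I_d).

(* The discriminant argument of Cauchy-Schwarz, in the degenerate case. *)
Lemma wint_mul_eq0 a (f g : Rd -> R) : -1 < a -> ball_bcont f -> ball_bcont g ->
  wint a (f \* f) = 0 -> wint a (f \* g) = 0.
Proof.
move=> a1 bf bg ff0.
have bZ (c : R) h : ball_bcont h -> ball_bcont (fun x => c * h x).
  by move=> bh; exact: ball_bcontM (ball_bcont_cst c) bh.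
have pos t : 0 <= 2 * t * wint a (f \* g) + wint a (g \* g).
  have -> : 2 * t * wint a (f \* g) + wint a (g \* g) =
      wint a (fun x => (t * f x + g x) ^+ 2).
    have bfg := ball_bcontM bf bg; have bgg := ball_bcontM bg bg.
    have bff := ball_bcontM bf bf.
    transitivity (wint a ((fun x => t ^+ 2 * (f \* f) x) \+
        ((fun x => (2 * t) * (f \* g) x) \+ (g \* g)))).
      rewrite !wintD//; try by [exact: bZ|apply: ball_bcontD => //; exact: bZ].
      by rewrite !wintZ// ff0 mulr0 add0r.
    by apply: eq_wint => x _ /=; ring.
  by apply: wint_ge0 => x; exact: sqr_ge0.
apply/eqP/negPn/negP => B0.
(* The value of [t] at which the affine function equals -1. *)
have := pos (- (wint a (g \* g) + 1) / (2 * wint a (f \* g))).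
rewrite (_ : 2 * _ * _ = - (wint a (g \* g) + 1)); last by field.
lra.
Qed.

Lemma add_ge0_eq0 (x y : R) : 0 <= x -> 0 <= y -> x + y = 0 -> x = 0 /\ y = 0.
Proof.
by move=> x0 y0 /eqP; rewrite paddr_eq0// => /andP[/eqP -> /eqP ->].
Qed.

(** The real and imaginary parts of every component have a vanishing square integral, as nonnegative
    terms of a zero sum. Degenerate Cauchy-Schwarz then gives orthogonality to every [grad v]
    directly, without passing through pointwise vanishing of the gradient. *)
Lemma ipv_grad_self_eq0 a p v : -1 < a -> cball_C1 v ->
  ipv a (grad (poly_fun p)) (grad (poly_fun p)) = 0 ->
  ipv a (grad (poly_fun p)) (grad v) = 0.
Proof.
move=> a1 v1 pp0.
have bp k : cball_bcont (partial k (poly_fun p)) by rewrite partial_poly; exact: cball_bcont_poly.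
pose r k := Re \o partial k (poly_fun p).
pose s k := Im \o partial k (poly_fun p).
have br k : ball_bcont (r k) := (bp k).1.
have bs k : ball_bcont (s k) := (bp k).2.
have ge0 (f : Rd -> R) : 0 <= wint a (f \* f).
  by apply: wint_ge0 => x; rewrite /= -expr2 sqr_ge0.
have Eip k w : cball_bcont w -> Re (ip a (partial k (poly_fun p)) w) =
    wint a (r k \* (Re \o w)) + wint a (s k \* (Im \o w)).
  move=> [wr wi]; rewrite ipE Re_cwint -wintD//; try exact: ball_bcontM.
  by apply: eq_wint => x _; rewrite /= ReM Re_conjc Im_conjc mulrN opprK.
have rs0 k : wint a (r k \* r k) = 0 /\ wint a (s k \* s k) = 0.
  have h : \sum_(k < d) (wint a (r k \* r k) + wint a (s k \* s k)) = 0.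
    transitivity (Re (ipv a (grad (poly_fun p)) (grad (poly_fun p)))).
      rewrite /ipv (big_morph Re ReD (erefl : Re 0 = 0)).
      by apply: eq_bigr => l _; rewrite (Eip l _ (bp l)).
    by rewrite pp0.
  have /(_ k isT) hk := psumr_eq0P (fun l _ => addr_ge0 (ge0 (r l)) (ge0 (s l))) h.
  exact: (add_ge0_eq0 (ge0 (r k)) (ge0 (s k)) hk).
rewrite /ipv big1// => k _.
have [vr vi] := cball_C1_partial k v1; have [r0 s0] := rs0 k.
rewrite ipE; apply: complex_ext; rewrite ?Re_cwint ?Im_cwint.
  transitivity (wint a (r k \* (Re \o partial k v)) + wint a (s k \* (Im \o partial k v))).
    rewrite -wintD//; [|exact: ball_bcontM|exact: ball_bcontM].
    apply: eq_wint => x _.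
    rewrite -[LHS]/(Re (partial k (poly_fun p) x * conjc (partial k v x))).
    by rewrite ReM Re_conjc Im_conjc mulrN opprK.
  by rewrite (wint_mul_eq0 a1 (br k) vr r0) (wint_mul_eq0 a1 (bs k) vi s0) addr0.
transitivity (wint a (r k \* (\- (Im \o partial k v))) + wint a (s k \* (Re \o partial k v))).
  by rewrite -wintD//; [exact: ball_bcontM (br k) (ball_bcontN vi)|
    exact: ball_bcontM (bs k) vr].
by rewrite (wint_mul_eq0 a1 (br k) (ball_bcontN vi) r0)
  (wint_mul_eq0 a1 (bs k) vr s0) addr0.
Qed.

Definition ball_const a : R[i] := (d%:R + 2 * a)%:C.

(** The gradient part contributes [2 (a + 1) E - (1 - |x|^2) Delta] and the angular part
    [E (E + d - 2) - |x|^2 Delta]. The terms with [|x|^2] cancel, which leaves constant coefficients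
    in [E] and [Delta] and the constant [d + 2a]. *)
Lemma Bform_poly a p v : -1 < a -> cball_C1 v ->
  Bform a (poly_fun p) v = ip a (poly_fun (ball_op (mpolyC d (ball_const a)) p)) v.
Proof.
move=> a1 v1; have bv := cball_C1_bcont v1.
pose F k := (2 * (a + 1))%:C *: ('X_k * mderiv k p) -
  gap_poly * mderiv k (mderiv k p).
pose G i j := - rot_poly i j (rot_poly i j p).
have E1 : ipv (a + 1) (grad (poly_fun p)) (grad v) =
    ip a (poly_fun (\sum_(k < d) F k)) v.
  rewrite (ip_poly_sum _ _ F a1 bv); apply: eq_bigr => k _.
  by rewrite /grad partial_poly; exact: ip_poly_partial a1 v1.
have E2 : \sum_(i < d) \sum_(j < d | (i < j)%N)
      ip a (angular i j (poly_fun p)) (angular i j v) =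
    ip a (poly_fun (\sum_(i < d) \sum_(j < d | (i < j)%N) G i j)) v.
  rewrite (ip_poly_sum _ _ _ a1 bv); apply: eq_bigr => i _.
  rewrite (ip_poly_sum _ _ _ a1 bv); apply: eq_bigr => j _.
  by rewrite angular_poly (ip_poly_angular _ _ _ a1 v1) /G (ip_polyN _ a1 bv).
rewrite /Bform E1 E2 -(ip_polyD _ _ a1 bv); congr (ip a (poly_fun _) v).
rewrite /F /G; under [X in _ + X]eq_bigr do rewrite sumrN.
rewrite sumrN sum_rot_poly sumrB -scaler_sumr -/(euler p) -mulr_sumr.
rewrite -/(laplace p) /ball_op /gap_poly -mul_mpolyC.
have -> : mpolyC d (ball_const a) = d%:R + mpolyC d (2 * (a + 1))%:C - 2.
  rewrite -!mpolyC_nat -mpolyCD -mpolyCB; congr (mpolyC d _).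
  by rewrite /ball_const mulrDr mulr1 !rmorphD/= !rmorph_nat; ring.
ring.
Qed.

Lemma Bform1_poly a p v : -1 < a -> (forall k, cball_C1 (partial k v)) ->
  Bform1 a (poly_fun p) v =
  ipv a (grad (poly_fun (sobolev_op (mpolyC d (ball_const a)) p))) (grad v).
Proof.
move=> a1 v1; apply: eq_bigr => k _.
rewrite partial_poly Bform_poly// /grad partial_poly mderiv_sobolev_op//.
exact: mderivC.
Qed.

Lemma ipv_conj (I : finType) a (U V : I -> Rd -> R[i]) : -1 < a ->
  (forall l, cball_bcont (U l)) -> (forall l, cball_bcont (V l)) ->
  ipv a V U = conjc (ipv a U V).
Proof.
move=> a1 bU bV; rewrite /ipv rmorph_sum; apply: eq_bigr => l _.
exact: ipC.
Qed.

Lemma Bform1_poly_conj a p q : -1 < a ->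
  Bform1 a (poly_fun q) (poly_fun p) = conjc (Bform1 a (poly_fun p) (poly_fun q)).
Proof.
move=> a1; rewrite /Bform1 rmorph_sum; apply: eq_bigr => k _.
rewrite /Bform [RHS]rmorphD !partial_poly; congr (_ + _).
  apply: ipv_conj => [|l|l]; first lra.
    by rewrite /grad partial_poly; exact: cball_bcont_poly.
  by rewrite /grad partial_poly; exact: cball_bcont_poly.
rewrite [RHS]rmorph_sum; apply: eq_bigr => i _.
rewrite [RHS]rmorph_sum; apply: eq_bigr => j _.
by rewrite !angular_poly; apply: ipC => //; exact: cball_bcont_poly.
Qed.

Lemma ipv_sobolev_op_sym a p q : -1 < a ->
  let M := sobolev_op (mpolyC d (ball_const a)) in
  ipv a (grad (poly_fun (M p))) (grad (poly_fun q)) =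
  ipv a (grad (poly_fun p)) (grad (poly_fun (M q))).
Proof.
move=> a1 M.
have C1 q' k : cball_C1 (partial k (poly_fun q')).
  by rewrite partial_poly; exact: cball_C1_poly.
rewrite -Bform1_poly// Bform1_poly_conj// Bform1_poly// -ipv_conj// => l.
  exact/cball_C1_bcont/C1.
exact/cball_C1_bcont/C1.
Qed.

Lemma ipv_gradB a p q (c : R[i]) v : -1 < a -> cball_C1 v ->
  ipv a (grad (poly_fun (p - mpolyC d c * q))) (grad v) =
  ipv a (grad (poly_fun p)) (grad v) - c * ipv a (grad (poly_fun q)) (grad v).
Proof.
move=> a1 v1; rewrite /ipv mulr_sumr -sumrB; apply: eq_bigr => k _.
have bk := cball_C1_partial k v1.
by rewrite /grad !partial_poly mul_mpolyC mderivB mderivZ ip_polyD// ip_polyN// ip_polyZ.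
Qed.

(** With abstract summands, the reordering of the sums stays separate from the integrals. *)
Lemma sum_pair_exchange (V : nmodType) (F : 'I_d -> 'I_d -> V)
    (G : 'I_d -> 'I_d -> 'I_d -> V) :
  \sum_(k < d) (\sum_(l < d) F k l +
    \sum_(i < d) \sum_(j < d | (i < j)%N) G i j k) =
  \sum_(kl : 'I_d * 'I_d) F kl.1 kl.2 +
    \sum_(i < d) \sum_(j < d | (i < j)%N) \sum_(k < d) G i j k.
Proof.
rewrite big_split /= pair_bigA /=; congr (_ + _).
by rewrite exchange_big /=; apply: eq_bigr => i _; rewrite exchange_big.
Qed.

Lemma Bform1E a u v :
  Bform1 a u v = ipv (a + 1) (hessian u) (hessian v) +
    \sum_(i < d) \sum_(j < d | (i < j)%N)
      ipv a (angular_vec i j (grad u)) (angular_vec i j (grad v)).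
Proof.
exact: (sum_pair_exchange
  (fun k l => ip (a + 1) (partial l (partial k u)) (partial l (partial k v)))
  (fun i j k => ip a (angular i j (partial k u)) (angular i j (partial k v)))).
Qed.

(** At a positive index the constant 1 is an admissible test polynomial, and its gradient is zero,
    so orthogonality to it kills the rank-one term. *)
Lemma orth_space_ip1 a n p v : -1 < a -> orth_space a n.+1 p ->
  ip1 a (poly_fun p) v = ipv a (grad (poly_fun p)) (grad v).
Proof.
move=> a1 [pn po]; rewrite /ip1.
have -> : (ip a (Defs.one_fun : Rd -> R[i]) Defs.one_fun)^-1 * ip a (poly_fun p) Defs.one_fun = 0.
  have /po : poly_space (Posz n.+1 - 1) (1 : poly).
    by rewrite -addn1 PoszD addrK /poly_space /= msize1.
  have -> : poly_fun (1 : poly) = Defs.one_fun.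
    by apply/funext => x; rewrite /poly_fun meval1.
  rewrite /ip1; set c := ip a Defs.one_fun Defs.one_fun.
  have -> : ipv a (grad (poly_fun p)) (grad Defs.one_fun) = 0.
    rewrite /ipv big1// => k _; rewrite ipE.
    rewrite (_ : grad Defs.one_fun k = fun=> 0); last first.
      by apply/funext => x; apply: cderivE; exact: cderiv_cst.
    rewrite (@eq_cwint _ _ _ _ (fun x => 0 * 0)); last first.
      by move=> x _; rewrite conjc0 !mulr0.
    by rewrite cwintZ ?mul0r//; exact: cball_bcont_cst.
  (* If the conjugate factor is the one that vanishes, then [c = 0], and the convention [0^-1 = 0]
     closes the case. *)
  rewrite add0r => /eqP; rewrite mulf_eq0 => /orP[/eqP//|].
  by rewrite conjc_eq0 => /eqP ->; rewrite invr0 mul0r.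
by rewrite mul0r addr0.
Qed.

Lemma ball_op0 C : ball_op C 0 = 0 :> poly.
Proof.
have e0 : euler 0 = 0 :> poly.
  by rewrite /euler big1// => k _; rewrite mderiv0 mulr0.
rewrite /ball_op !e0 /laplace big1 ?mulr0 ?addr0 ?subr0// => k _.
by rewrite !mderiv0.
Qed.

(** At index 1 the default branch and the formula agree, since the factor [n - 1] is zero; at index
    0 they need not, hence the successor. *)
Lemma lambda1E a n :
  (lambda1 d a n.+1)%:C = top_eigenvalue (ball_const a) n.+1.
Proof.
rewrite -(rmorph_top_eigenvalue (real_complex R)); congr (_%:C).
rewrite /lambda1 /top_eigenvalue ltnS leqn0 -addrA.
by case: eqVneq => [->|//]; rewrite subrr mul0r.
Qed.

Lemma Bform1_orth_space a n p v : -1 < a -> orth_space a n p -> Cbar 2 v ->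
  Bform1 a (poly_fun p) v = (lambda1 d a n)%:C * ip1 a (poly_fun p) v.
Proof.
move=> a1 po vC2; have v1 := CbarS_C1 vC2.
have dv1 k : cball_C1 (partial k v).
  by have [_ /(_ k)[_ h]] := vC2; exact: (@CbarS_C1 R d 0 _ h).
rewrite Bform1_poly//; set M := sobolev_op _.
case: n po => [|n] po.
  rewrite mul0r /ipv big1// => k _.
  have [/msize1_polyC -> _] := po.
  (* A constant [p] need not be killed by [M], but [d_k M p = L (d_k p) = 0]. *)
  rewrite /grad partial_poly mderiv_sobolev_op ?mderivC// ball_op0.
  by apply: ip_poly0 => //; exact/cball_C1_bcont.
rewrite (orth_space_ip1 _ a1 po) lambda1E; set l := top_eigenvalue _ _.
have [pn porth] := po.
have G0 s : (msize s <= n.+1)%N ->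
    ipv a (grad (poly_fun p)) (grad (poly_fun s)) = 0.
  move=> sn; rewrite -(orth_space_ip1 _ a1 po); apply: porth.
  by rewrite -addn1 PoszD addrK.
(* The index is now [n + 1], so this bound says that the remainder lies in the space of test
   polynomials. *)
have rn : (msize (M p - mpolyC d l * p) <= n.+1)%N.
  exact: msize_sobolev_op_top.
apply/eqP; rewrite -subr_eq0 -ipv_gradB//; apply/eqP.
apply: ipv_grad_self_eq0 => //; rewrite ipv_gradB//; last exact: cball_C1_poly.
(* In the product of [grad r] with itself, [M] moves to the right factor; [M r] and [r] both have
   degree at most [n], so both pairings with [grad p] vanish. *)
by rewrite ipv_sobolev_op_sym// !G0 ?mulr0 ?subr0//; exact: msize_sobolev_op.
Qed.

End spectral_identity.

Theorem theorem3p11 (R : realType) (d : nat) (alpha : R) (n : nat)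
    (pn : mpoly d R[i]) (q : 'rV[R]_d -> R[i])
    (d_gt0 : (0 < d)%N) (alpha_gtN1 : -1 < alpha)
    (pnV : orth_space alpha n pn) (qC2 : Cbar 2 q) :
  Bform1 alpha (poly_fun pn) q =
    ipv (alpha + 1) (hessian (poly_fun pn)) (hessian q) +
    \sum_(i < d) \sum_(j < d | (i < j)%N)
      ipv alpha (angular_vec i j (grad (poly_fun pn)))
        (angular_vec i j (grad q)) /\
    ipv (alpha + 1) (hessian (poly_fun pn)) (hessian q) +
    \sum_(i < d) \sum_(j < d | (i < j)%N)
      ipv alpha (angular_vec i j (grad (poly_fun pn)))
        (angular_vec i j (grad q)) =
    (lambda1 d alpha n)%:C * ip1 alpha (poly_fun pn) q.
Proof.
split; first exact: Bform1E.
by rewrite -Bform1E; exact: Bform1_orth_space.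
Qed.
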